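(* Let $X$ be an infinite compact abelian group with $G = \widehat X$. Then: (1) $\widetilde{\mathcal C}_B$ is a Haar null set for each infinite $B \subseteq G$. (2) For any countable $Q \subseteq X$, there is an infinite $B \subseteq \widehat X$ such that $Q \subseteq \mathcal C_B$, $\mathcal C_B$ contains a perfect subset, and $\mathcal C_B$ is dense in $X$. (3) $\lambda(\overline B) \le 1/|\widetilde{\mathcal C}_B|$ for all infinite $B \subseteq G$. Here $\overline B$ is the closure of $B$ in $\mathsf b G$, $\lambda$ is the Haar probability measure on $\mathsf b G$, and $1/|\widetilde{\mathcal C}_B| = 0$ when $|\widetilde{\mathcal C}_B|$ is infinite.
   Context: All spaces are Hausdorff. $\mathbb T \subset \mathbb C$ is the circle group; for a compact abelian group $X$, $\widehat X$ is the group of all continuous homomorphisms (characters) $X \to \mathbb T$. For infinite $B \subseteq \widehat X$ and $y \in \mathbb T$, $\mathcal C_B(y)$ is the set of all $x \in X$ such that $\langle \varphi(x) : \varphi \in B\rangle$ converges to $y$, meaning that every neighborhood of $y$ contains $\varphi(x)$ for all but finitely many $\varphi \in B$. Put $\mathcal C_B = \mathcal C_B(1)$ and $\widetilde{\mathcal C}_B = \bigcup_{y \in \mathbb T} \mathcal C_B(y)$; both are subgroups of $X$. ''Haar null'' means of measure $0$ for the (completed) Haar probability measure. A perfect set is a nonempty closed set without isolated points. With $G = \widehat X$ regarded as a subset of $\mathbb T^X$ (product topology), $\mathsf b G$ (the Bohr compactification of the discrete group $G$) is the closure of $G$ in $\mathbb T^X$, a compact abelian group. *)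

(* Defs.v *)
From HB Require Import structures.
From mathcomp Require Import all_boot all_order all_algebra finmap.
From mathcomp Require Import complex.
From mathcomp Require Import all_classical all_reals all_analysis.

Set Implicit Arguments.
Unset Strict Implicit.
Unset Printing Implicit Defensive.

Import Order.TTheory GRing.Theory Num.Theory.
Import numFieldNormedType.Exports.

Local Open Scope classical_set_scope.
Local Open Scope ring_scope.

Lemma initial_cvg (S : choiceType) (T : topologicalType) (f : S -> T)
    (F : set_system S) {FF : Filter F} (s : S) :
  f @ F --> f s -> F --> (s : initial_topology f).
Proof.
move=> Fs U [_ [[W oW <-] Ws WU]].
have /Fs : nbhs (f s) W by apply: open_nbhs_nbhs.
exact: (@filterS _ F FF _ _ WU).
Qed.

(* Giving R[i] the type numClosedFieldType makes its norm topology available. *)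
Definition Cplx (R : realType) : numClosedFieldType := R[i].

(* The circle group, with the subspace topology of the complex plane. Abelian
   groups are additive (zmodType) throughout, so on [circle R] the operation [+]
   is multiplication of complex numbers and [0] is the complex number 1. *)
Definition circle (R : realType) : Type := set_type [set z : Cplx R | `|z| = 1].

HB.instance Definition _ (R : realType) := SubChoice.on (circle R).
HB.instance Definition _ (R : realType) := Topological.on (circle R).

Section CircleGroup.
Variable R : realType.
Implicit Types u v w : circle R.

Let normu u : `|\val u| = 1. Proof. exact: set_valP u. Qed.

Let one_subproof : (1 : Cplx R) \in [set z : Cplx R | `|z| = 1].
Proof. by rewrite inE /= normr1. Qed.

Let mul_subproof u v : \val u * \val v \in [set z : Cplx R | `|z| = 1].
Proof. by rewrite inE /= normrM !normu mulr1. Qed.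

Let inv_subproof u : (\val u)^-1 \in [set z : Cplx R | `|z| = 1].
Proof. by rewrite inE /= normfV normu invr1. Qed.

Local Notation SigSub := (@exist (Cplx R) (fun z => z \in [set z | `|z| = 1]) _).

Definition circle_one : circle R := SigSub one_subproof.
Definition circle_mul u v : circle R := SigSub (mul_subproof u v).
Definition circle_inv u : circle R := SigSub (inv_subproof u).

Let circle_mulA : associative circle_mul.
Proof. by move=> u v w; apply: val_inj; rewrite /= mulrA. Qed.

Let circle_mulC : commutative circle_mul.
Proof. by move=> u v; apply: val_inj; rewrite /= mulrC. Qed.

Let circle_mul1 : left_id circle_one circle_mul.
Proof. by move=> u; apply: val_inj; rewrite /= mul1r. Qed.

Let circle_neq0 u : \val u != 0.
Proof. by rewrite -normr_gt0 normu ltr01. Qed.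

Let circle_mulV : left_inverse circle_one circle_inv circle_mul.
Proof. by move=> u; apply: val_inj; rewrite /= mulVf ?circle_neq0. Qed.

HB.instance Definition _ := GRing.isZmodule.Build (circle R)
  circle_mulA circle_mulC circle_mul1 circle_mulV.

Let val_continuous : continuous (\val : circle R -> Cplx R).
Proof. exact: (@initial_continuous (circle R) (Cplx R) set_val). Qed.

Let circle_sub_continuous :
  continuous (fun uv : circle R * circle R => uv.1 - uv.2).
Proof.
move=> [u v].
apply: (@initial_cvg (circle R) (Cplx R) set_val) => /=.
apply: (@cvgM (Cplx R) _ (nbhs (u, v)) _ (fun uv => \val uv.1 : Cplx R)
  (fun uv => (\val uv.2 : Cplx R)^-1) (\val u) (\val v)^-1).
  by apply: (cvg_comp _ _ cvg_fst); exact: val_continuous.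
apply: cvgV; first exact: circle_neq0.
by apply: (cvg_comp _ _ cvg_snd); exact: val_continuous.
Qed.

HB.instance Definition _ :=
  PreTopologicalNmodule_isTopologicalZmodule.Build (circle R)
    circle_sub_continuous.

End CircleGroup.

Section PowerGroup.
Variables (I : Type) (M : topologicalZmodType).

HB.instance Definition _ := GRing.Zmodule.copy {ptws I -> M} (I -> M).

Let ptws_sub_continuous :
  continuous (fun fg : {ptws I -> M} * {ptws I -> M} => fg.1 - fg.2).
Proof.
have ev (i : I) : continuous (fun f : {ptws I -> M} => f i).
  exact: (@proj_continuous {classic I} (fun=> M) i).
move=> [f g]; apply/cvg_sup => i; apply: initial_cvg => /=.
have := @continuous2_cvg _ M M M (nbhs (f, g)) _ (fun fg => fg.1 i)
  (fun fg => fg.2 i) (fun x y => x - y) (f i) (g i).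
apply; first exact: (@sub_continuous M (f i, g i)).
  by apply: (@cvg_comp _ _ _ fst (fun h : {ptws I -> M} => h i) _ (nbhs f) _
    cvg_fst); exact: ev.
by apply: (@cvg_comp _ _ _ snd (fun h : {ptws I -> M} => h i) _ (nbhs g) _
    cvg_snd); exact: ev.
Qed.

HB.instance Definition _ :=
  PreTopologicalNmodule_isTopologicalZmodule.Build {ptws I -> M}
    ptws_sub_continuous.

End PowerGroup.

Definition dual (R : realType) (X : topologicalZmodType) :
    set {ptws X -> circle R} :=
  [set phi | continuous (phi : X -> circle R) /\ {morph phi : x y / x + y}].

(* The Bohr compactification of the discrete group [dual R X]; its group
   structure and topology are those inherited from {ptws X -> circle R}. *)
Definition bohr (R : realType) (X : topologicalZmodType) : Type :=
  set_type (closure (@dual R X)).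

HB.instance Definition _ (R : realType) (X : topologicalZmodType) :=
  SubChoice.on (bohr R X).
HB.instance Definition _ (R : realType) (X : topologicalZmodType) :=
  Topological.on (bohr R X).

Section BohrGroup.
Variables (R : realType) (X : topologicalZmodType).

Let dualB (phi psi : {ptws X -> circle R}) :
  dual phi -> dual psi -> dual (phi - psi).
Proof.
move=> [cphi mphi] [cpsi mpsi]; split; last first.
  move=> x y; rewrite [LHS]/(phi (x + y) - psi (x + y)).
  by rewrite mphi mpsi opprD addrACA.
move=> x; have := @continuous2_cvg _ (circle R) (circle R) (circle R) (nbhs x) _
  phi psi (fun y z => y - z) (phi x) (psi x).
apply; first exact: (@sub_continuous (circle R) (phi x, psi x)).
  exact: cphi.
exact: cpsi.
Qed.

Let dual0 : dual (0 : {ptws X -> circle R}).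
Proof.
by split=> [x|x y]; [exact: cvg_cst|rewrite [RHS]addr0].
Qed.

Let bohr_zmod_closed :
  zmod_closed (fun f : {ptws X -> circle R} => f \in closure (@dual R X)).
Proof.
split=> [|f g]; rewrite !inE; first exact/subset_closure/dual0.
move=> clf clg U /(@sub_continuous {ptws X -> circle R} (f, g)).
move=> [[V W] /= [fV gW] VWU].
have [phi [dphi Vphi]] := clf _ fV; have [psi [dpsi Wpsi]] := clg _ gW.
by exists (phi - psi); split; [exact: dualB|exact: (VWU (phi, psi))].
Qed.

HB.instance Definition _ :=
  GRing.SubChoice_isSubZmodule.Build {ptws X -> circle R}
    (fun f => f \in closure (@dual R X)) (bohr R X) bohr_zmod_closed.

Let val_continuous : continuous (\val : bohr R X -> {ptws X -> circle R}).
Proof.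
exact: (@initial_continuous (bohr R X) {ptws X -> circle R} set_val).
Qed.

Let bohr_sub_continuous :
  continuous (fun uv : bohr R X * bohr R X => uv.1 - uv.2).
Proof.
move=> [u v].
apply: (@initial_cvg (bohr R X) {ptws X -> circle R} set_val) => /=.
have := @continuous2_cvg _ {ptws X -> circle R} {ptws X -> circle R}
  {ptws X -> circle R} (nbhs (u, v)) _ (fun uv => \val uv.1)
  (fun uv => \val uv.2) (fun f g => f - g) (\val u) (\val v).
apply; first exact: (@sub_continuous {ptws X -> circle R} (\val u, \val v)).
  by apply: (cvg_comp _ _ cvg_fst); exact: val_continuous.
by apply: (cvg_comp _ _ cvg_snd); exact: val_continuous.
Qed.

HB.instance Definition _ :=
  PreTopologicalNmodule_isTopologicalZmodule.Build (bohr R X)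
    bohr_sub_continuous.

End BohrGroup.

(* The base point is only there because measurable types are pointed. *)
Definition pointed_group (X : topologicalZmodType) : Type := X.

HB.instance Definition _ (X : topologicalZmodType) :=
  TopologicalZmodule.on (pointed_group X).
HB.instance Definition _ (X : topologicalZmodType) :=
  isPointed.Build (pointed_group X) 0.

Definition borel (X : topologicalZmodType) :=
  g_sigma_algebraType (@open (pointed_group X)).

Section Haar.
Variables (R : realType) (X : topologicalZmodType).

(* The Haar probability measure of a compact abelian group [X], characterized
   as its unique translation-invariant regular Borel probability measure. *)
Record is_haar (mu : probability (borel X) R) : Prop := IsHaar {
  haar_translation : forall (a : X) (A : set (borel X)), measurable A ->
    mu [set a + x | x in (A : set X)] = mu A;
  haar_outer_regular : forall A : set (borel X), measurable A ->
    mu A = ereal_inf [set mu U | U in [set U : set X | open U /\ A `<=` U]];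
  haar_inner_regular : forall U : set X, open U ->
    mu U = ereal_sup [set mu K | K in [set K : set X | compact K /\ K `<=` U]]
}.

End Haar.

Section ConvergenceSets.
Variables (R : realType) (X : topologicalZmodType).
Implicit Types (B : set {ptws X -> circle R}) (y : circle R).

Definition conv_to B y : set X :=
  [set x | forall U, nbhs y U -> finite_set (B `&` [set phi | ~ U (phi x)])].

Definition conv_one B : set X := conv_to B 0.

Definition conv_any B : set X := \bigcup_(y in [set: circle R]) conv_to B y.

End ConvergenceSets.

Definition bohr_closure (R : realType) (X : topologicalZmodType)
    (B : set {ptws X -> circle R}) : set (bohr R X) :=
  closure [set g : bohr R X | B (\val g)].

Definition inv_card (R : realType) (T : choiceType) (A : set T) : R :=
  if `[< finite_set A >] then (#|` fset_set A|%:R)^-1 else 0.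

(* Main.v *)
Require Import Defs.
From mathcomp Require Import all_boot all_order all_algebra finmap.
From mathcomp Require Import complex.
From mathcomp Require Import all_classical all_reals all_analysis.
From mathcomp Require Import measurable_realfun.
From mathcomp Require Import ring lra.

Set Implicit Arguments.
Unset Strict Implicit.
Unset Printing Implicit Defensive.

Import Order.TTheory GRing.Theory Num.Theory.
Import numFieldNormedType.Exports.

Local Open Scope classical_set_scope.
Local Open Scope ring_scope.

(** Everything rests on two facts about a translation-invariant probability on a
    topological group and [n] distinct characters of it.  The characters are
    orthonormal, so the squared modulus of a sum of [n] of them, each multiplied
    by a constant of modulus [1], has integral [n]; and where the [n] terms point
    in nearly the same direction that squared modulus is nearly [n ^ 2].  Hence
    the set of such points has measure at most about [1 / n]
    ([cluster_set_mass]).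

    For part (1), a point at which infinitely many characters of [B] converge
    lies, from some index on, in such a set for arbitrarily many characters of
    [X].  For part (3), the roles are exchanged: points [x] of [X] are characters
    of the Bohr compactification by evaluation, and if [n] distinct points belong
    to [conv_any B], then all but finitely many elements of [B] lie in a closed
    set on which the [n] evaluations are nearly constant.  Distinct points have
    distinct evaluations only because the continuous characters of [X] separate
    its points, which also makes the dual infinite, as part (2) needs.

    Separation of points ([characters_separate]) is proved without measures.  A
    compact group has an invariant mean on continuous functions, obtained as a
    limit of finite averages of translates.  It yields continuous positive
    definite functions [k], the autocorrelations.  Among all normalized positive
    definite functions [f] on [X], continuous or not, consider those that maximize
    the infimum of the averages of [f * k] over differences of points of finite
    sets; in terms of Fourier series this infimum is the sum over the continuous
    characters of the products of the coefficients of [f] and of [k].  The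
    maximizers form a nonempty closed face of a compact set, so one of them is
    extreme ([face_extreme], [extreme_maximizer]).  An extreme positive definite
    function satisfies d'Alembert's equation [f (x + a) + f (x - a) = 2 f x f a]
    ([extreme_dalembert]), hence is the real part of a character
    ([dalembert_character]); it is continuous because the infimum is positive
    ([energy_unif_cont]).  Taking for [k] the autocorrelation of a difference
    [g - g (. + x0)] forces [f x0 <> 1] ([energy_nontrivial]).

    For part (2), fix an infinite sequence [d] of characters and let [K] be the
    intersection of their kernels.  By the pigeonhole principle, differences of
    the [d n] can be made small at any finitely many points, and so they can be
    made to converge on any sequence of points.  A sequence of points whose
    translates by [K] are dense takes care of density.  For the perfect set,
    characters [e n] and points [a n] outside [K] are chosen alternately, each
    very small against the previous ones ([interleaved_choice]): then the [e n]
    converge uniformly on the set of all finite sums of distinct [a i] plus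
    elements of [K], and the closure of this set has no isolated point. *)

(** * The circle group *)

Section Circle.
Variable R : realType.
Implicit Types u v w : circle R.

Definition re u : R := complex.Re (\val u).
Definition im u : R := complex.Im (\val u).

(** The Euclidean distance from [u] to the neutral element, in real terms. *)
Definition gauge u : R := Num.sqrt (2 - 2 * re u).

Lemma re2Dim2 u : re u ^+ 2 + im u ^+ 2 = 1.
Proof.
have : `|\val u| = 1 := set_valP u.
rewrite /re /im; case: (\val u) => a b /= /eqP.
rewrite eq_complex /= => /andP[/eqP h _].
have : (Num.sqrt (a ^+ 2 + b ^+ 2)) ^+ 2 = 1 by rewrite h expr1n.
by rewrite sqr_sqrtr// addr_ge0 ?sqr_ge0.
Qed.

Lemma circle_inj u v : re u = re v -> im u = im v -> u = v.
Proof.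
move=> h1 h2; apply: val_inj; move: h1 h2; rewrite /re /im.
by case: (\val u) => a b; case: (\val v) => c d /= -> ->.
Qed.

Lemma circle_ex (a b : R) : a ^+ 2 + b ^+ 2 = 1 ->
  {u : circle R | re u = a & im u = b}.
Proof.
move=> ab.
have h : (Complex a b : Cplx R) \in [set z : Cplx R | `|z| = 1].
  rewrite inE /=; apply/eqP; rewrite eq_complex /= eqxx andbT.
  by rewrite ab sqrtr1.
by exists (@exist (Cplx R) (fun z => z \in [set z | `|z| = 1]) _ h).
Qed.

Lemma re0 : re 0 = 1. Proof. by []. Qed.
Lemma im0 : im 0 = 0. Proof. by []. Qed.

Lemma reD u v : re (u + v) = re u * re v - im u * im v.
Proof.
rewrite /re /im; have -> : \val (u + v) = \val u * \val v by [].
by case: (\val u) => a b; case: (\val v).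
Qed.

Lemma imD u v : im (u + v) = re u * im v + im u * re v.
Proof.
rewrite /re /im; have -> : \val (u + v) = \val u * \val v by [].
by case: (\val u) => a b; case: (\val v).
Qed.

Lemma reN u : re (- u) = re u.
Proof.
have := reD u (- u); have := imD u (- u); rewrite subrr re0 im0 => h1 h2.
rewrite -[LHS]mulr1 -[X in _ * X](re2Dim2 u).
transitivity (re u * (re u * re (- u) - im u * im (- u))
  + im u * (re u * im (- u) + im u * re (- u))); first by ring.
by rewrite -h1 -h2 mulr1 mulr0 addr0.
Qed.

Lemma imN u : im (- u) = - im u.
Proof.
have := reD u (- u); have := imD u (- u); rewrite subrr re0 im0 reN => h1 h2.
rewrite -[LHS]mulr1 -[X in _ * X](re2Dim2 u).
transitivity (re u * (re u * im (- u) + im u * re u)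
  - im u * (re u * re u - im u * im (- u))); first by ring.
by rewrite -h1 -h2 mulr1 mulr0 sub0r.
Qed.

Lemma reB u v : re (u - v) = re u * re v + im u * im v.
Proof. by rewrite reD reN imN mulrN opprK. Qed.

Lemma re_le1 u : re u <= 1.
Proof. by have := re2Dim2 u; have := sqr_ge0 (im u); nra. Qed.

Lemma re_geN1 u : -1 <= re u.
Proof. by have := re2Dim2 u; have := sqr_ge0 (im u); nra. Qed.

Lemma im_itv u : -1 <= im u <= 1.
Proof.
by have := re2Dim2 u; have := sqr_ge0 (re u); move=> ? ?; apply/andP; split; nra.
Qed.

Lemma re_eq1 u : re u = 1 -> u = 0.
Proof.
move=> h; apply: circle_inj; rewrite ?h //.
have := re2Dim2 u; rewrite h expr1n => h2.
by apply/eqP; rewrite -sqrf_eq0; apply/eqP; lra.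
Qed.

Lemma gauge_ge0 u : 0 <= gauge u. Proof. exact: sqrtr_ge0. Qed.

Lemma gauge2 u : gauge u ^+ 2 = 2 - 2 * re u.
Proof. by rewrite sqr_sqrtr//; have := re_le1 u; lra. Qed.

Lemma gauge0 : gauge 0 = 0.
Proof. by rewrite /gauge re0 mulr1 subrr sqrtr0. Qed.

Lemma gaugeN u : gauge (- u) = gauge u.
Proof. by rewrite /gauge reN. Qed.

Lemma gaugeB u v : gauge (u - v) = gauge (v - u).
Proof. by rewrite -gaugeN opprB. Qed.

Lemma gauge_eq0 u : gauge u = 0 -> u = 0.
Proof. by move=> h; apply: re_eq1; have := gauge2 u; rewrite h; lra. Qed.

Lemma norm_valB u v : `|\val u - \val v : Cplx R| = (gauge (u - v))%:C%C.
Proof.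
apply/eqP; rewrite eq_complex; rewrite /gauge reB.
have := re2Dim2 u; have := re2Dim2 v; rewrite /re /im.
case: (\val u) => a b; case: (\val v) => c d /= h1 h2.
rewrite eqxx andbT; apply/eqP; congr Num.sqrt.
by transitivity ((a ^+ 2 + b ^+ 2) + (c ^+ 2 + d ^+ 2) - 2 * (a * c + b * d));
  [ring|rewrite h1 h2].
Qed.

(** Translating by [u] is an isometry of the plane, so this is the triangle
    inequality for the points [0], [u] and [u + v] of the circle. *)
Lemma gaugeD u v : gauge (u + v) <= gauge u + gauge v.
Proof.
have := ler_normD (\val (u + v) - \val u : Cplx R) (\val u - \val (0 : circle R)).
rewrite addrA subrK !norm_valB !subr0 addrAC subrr add0r.
rewrite -rmorphD /= => h; rewrite -lecR [gauge u + _]addrC; exact: h.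
Qed.

Lemma val_circle_continuous : continuous (\val : circle R -> Cplx R).
Proof. exact: (@initial_continuous (circle R) (Cplx R) set_val). Qed.

Lemma nbhs_circleP u (U : set (circle R)) :
  nbhs u U <-> exists2 e, 0 < e & forall v, gauge (v - u) < e -> U v.
Proof.
split.
  move=> [_ [[W oW <-] Wu WU]].
  have : nbhs (\val u : Cplx R) W by apply: open_nbhs_nbhs.
  move=> /nbhs_ballP[[e e'] /= /andP[/eqP /= e'0 e0] eW].
  exists e => // v huv; apply: WU; apply: eW.
  rewrite /ball /= -[X in X < _]/(`|\val u - \val v : Cplx R|).
  by rewrite norm_valB gaugeB e'0 ltcR.
move=> [e e0 eU].
have [B hB eB] : exists2 B : set (Cplx R), nbhs (\val u : Cplx R) B &
    forall z, B z -> `|\val u - z| < (e%:C)%C.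
  exists (ball (\val u : Cplx R) ((e%:C)%C : Cplx R)).
    by apply: nbhsx_ballx; rewrite ltcR.
  by move=> z; rewrite -ball_normE.
have : nbhs u ((\val : circle R -> Cplx R) @^-1` B).
  exact: val_circle_continuous hB.
apply: filterS => v Bv; apply: eU.
by have := eB _ Bv; rewrite norm_valB gaugeB ltcR.
Qed.

Lemma re_continuous : continuous re.
Proof.
move=> u U /nbhs_ballP[e e0 eU]; apply/nbhs_circleP; exists e => // v huv.
apply: eU; rewrite /ball /= distrC; apply: le_lt_trans huv.
rewrite -(@ler_pXn2r _ 2)// ?nnegrE ?gauge_ge0// real_normK ?num_real//.
rewrite gauge2 reB; have := re2Dim2 u; have := re2Dim2 v.
have := sqr_ge0 (im u - im v); nra.
Qed.

(** As long as [u] is within distance [1] of the neutral element, doubling [u]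
    multiplies [1 - re u] by at least [3 / 2]. *)
Lemma no_small_subgroup u : (forall n, gauge (u *+ n) < 1) -> u = 0.
Proof.
move=> small.
have re_gt n : 1 / 2 < re (u *+ n).
  by have := small n; have := gauge2 (u *+ n); have := gauge_ge0 (u *+ n); nra.
have grow n : (3 / 2) ^+ n * (1 - re u) <= 1 - re (u *+ (2 ^ n)).
  elim: n => [|n ih]; first by rewrite expr0 mul1r expn0 mulr1n.
  rewrite expnS mul2n -addnn mulrnDr.
  have := re_gt (2 ^ n)%N; move: ih; set x := u *+ _ => ih hx.
  have h := re2Dim2 x; rewrite reD exprS -mulrA.
  have : 0 <= (1 - re x) * (re x - 1 / 2).
    by apply: mulr_ge0; [have := re_le1 x|]; lra.
  by move: ih h; set p := _ * _; nra.
apply: re_eq1; apply: contrapT => /eqP; rewrite neq_lt ltNge ?re_le1.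
rewrite [1 < _]ltNge re_le1 orbF /= => h.
have {h} d0 : 0 < 1 - re u by rewrite subr_gt0 ltNge.
have bern n : 1 + n%:R / 2 <= (3 / 2 : R) ^+ n.
  elim: n => [|n ih]; first by rewrite mul0r addr0 expr0.
  by rewrite exprS -natr1; have : 0 <= n%:R :> R by []; nra.
pose n := (Num.truncn (2 / (1 - re u))).+1.
have : 2 / (1 - re u) < n%:R by exact: truncnS_gt.
rewrite ltr_pdivrMr// => h1.
have := grow n; have := bern n; have := re_gt (2 ^ n)%N.
have : 0 <= n%:R :> R by [].
nra.
Qed.

End Circle.
(** * Compact topological groups *)

Lemma continuousB_fun (R : realType) (T : topologicalType) (f g : T -> R) :
  continuous f -> continuous g -> continuous (fun x => f x - g x).
Proof. by move=> cf cg x; apply: cvgB; [exact: cf|exact: cg]. Qed.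

Lemma continuousM_fun (R : realType) (T : topologicalType) (f g : T -> R) :
  continuous f -> continuous g -> continuous (fun x => f x * g x).
Proof. by move=> cf cg x; apply: cvgM; [exact: cf|exact: cg]. Qed.

Lemma continuous_cst_fun (R : realType) (T : topologicalType) (c : R) :
  continuous (fun _ : T => c).
Proof. by move=> x; exact: cvg_cst. Qed.

Lemma continuous_sum (R : realType) (T : topologicalType) (I : Type) (r : seq I)
    (F : I -> T -> R) :
  (forall i, continuous (F i)) -> continuous (fun x => \sum_(i <- r) F i x).
Proof.
move=> cF; elim: r => [|i r ih].
  have -> : (fun x => \sum_(i <- [::]) F i x) = fun=> 0.
    by apply/funext => x; rewrite big_nil.
  by move=> x; exact: cvg_cst.
have -> : (fun x => \sum_(j <- i :: r) F j x) =
    (fun x => F i x + \sum_(j <- r) F j x).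
  by apply/funext => x; rewrite big_cons.
by move=> x; apply: cvgD; [exact: cF|exact: ih].
Qed.

Section TopologicalGroups.
Variables (R : realType) (X : topologicalZmodType).
Implicit Types (x y : X) (U V : set X).

Lemma continuous_addl x : continuous (fun y : X => x + y).
Proof.
move=> y; apply: (@continuous2_cvg _ X X X (nbhs y) _ (fun=> x) id +%R x y).
- exact: (@add_continuous X (x, y)).
- exact: cvg_cst.
- exact: cvg_id.
Qed.

Lemma continuous_addr x : continuous (fun y : X => y + x).
Proof.
have -> : (fun y : X => y + x) = (fun y => x + y).
  by apply/funext => y; rewrite addrC.
exact: continuous_addl.
Qed.

Lemma nbhs_shift x U : nbhs x U <-> nbhs 0 [set u | U (u + x)].
Proof.
split => h.
  have := @continuous_addr x 0; rewrite /continuous_at add0r; exact.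
have := @continuous_addr (- x) x; rewrite /continuous_at subrr => /(_ _ h).
by rewrite /= /nbhs /=; apply: filterS => y; rewrite /= subrK.
Qed.

Lemma nbhs0_opp U : nbhs 0 U -> nbhs 0 [set u | U (- u)].
Proof.
move=> hU; have := @opp_continuous X 0; rewrite /continuous_at oppr0.
exact.
Qed.

Hypothesis X_compact : compact [set: X].

(** Total boundedness; the translates of the interior of [U] are an open cover. *)
Lemma finite_translates U : nbhs 0 U ->
  exists s : seq X, forall x, exists2 b, b \in s & U (x - b).
Proof.
move=> hU; have : @cover_compact (pointed_group X) [set: X].
  by rewrite -compact_cover.
move=> /(_ X setT (fun b => [set x | U (x - b)]^°)).
case.
- by move=> b _; exact: open_interior.
- move=> x _; exists x => //; rewrite /interior.
  apply/(nbhs_shift x); apply: filterS hU => u /=.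
  by rewrite addrK.
move=> D _ h; exists (enum_fset D) => x; have [b bD hb] := h x I.
by exists b => //; apply: interior_subset hb.
Qed.

Definition unif_cont (f : X -> R) := forall e, 0 < e ->
  nbhs 0 [set u | forall x, `|f (u + x) - f x| <= e].

Lemma continuous_unif_cont (f : X -> R) : continuous f -> unif_cont f.
Proof.
move=> cf e e0.
have /compact_near_coveringP := X_compact.
move=> /(_ X (nbhs 0) (fun u x => `|f (u + x) - f x| <= e)).
have h x : setT x -> \forall x' \near x & i \near (0 : X), `|f (i + x') - f x'| <= e.
  move=> _.
  have c1 : (fun p : X * X => f (p.2 + p.1)) @ (x, 0 : X) --> f x.
    rewrite -{2}[x]add0r.
    apply: (@cvg_comp _ _ _ (fun p : X * X => p.2 + p.1) f).
      apply: (@continuous2_cvg _ X X X (nbhs (x, 0 : X)) _ snd fst +%R 0 x).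
      - exact: (@add_continuous X (0, x)).
      - exact: cvg_snd.
      - exact: cvg_fst.
    exact: cf.
  have c2 : (fun p : X * X => f p.1) @ (x, 0 : X) --> f x.
    by apply: (@cvg_comp _ _ _ fst f _ (nbhs x)); [exact: cvg_fst|exact: cf].
  have c3 : (fun p : X * X => f (p.2 + p.1) - f p.1) @ (x, 0 : X) --> (0 : R).
    by rewrite -(subrr (f x)); apply: cvgB.
  have /cvgr0_norm_le := c3; move/(_ e e0).
  by [].
move=> /(_ _ h); apply: filterS => u /= hu x; exact: hu.
Qed.

Lemma unif_cont_continuous (f : X -> R) : unif_cont f -> continuous f.
Proof.
move=> uf x; apply/cvgrPdist_le => e e0.
apply/(nbhs_shift x); apply: filterS (uf e e0) => u /= hu.
by rewrite distrC.
Qed.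

Lemma continuous_bounded (f : X -> R) : continuous f ->
  exists M, forall x, `|f x| <= M.
Proof.
move=> /continuous_unif_cont/(_ 1 ltr01)/finite_translates[s hs].
exists (1 + \sum_(b <- s) `|f b|) => x; have [b bs /(_ b)] := hs x.
rewrite subrK => h; rewrite (le_trans (_ : _ <= 1 + `|f b|))//.
  by rewrite -[f x](subrK (f b)) (le_trans (ler_normD _ _))// lerD2r.
rewrite lerD2l (big_rem b)//= lerDl.
by apply: sumr_ge0 => ? _.
Qed.

End TopologicalGroups.
(** * The invariant mean of a compact group *)

Section Averages.
Variables (R : realType) (X : zmodType).
Implicit Types (f g : X -> R) (s t : seq X) (x y a b : X).

Definition avg s f x : R := (\sum_(a <- s) f (x + a)) / (size s)%:R.

Lemma size_gt0R s : (0 < size s)%N -> 0 < (size s)%:R :> R.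
Proof. by rewrite ltr0n. Qed.

Lemma avg_le s f c x : (0 < size s)%N -> (forall y, f y <= c) -> avg s f x <= c.
Proof.
move=> s0 fc; rewrite ler_pdivrMr ?size_gt0R//.
rewrite (le_trans (ler_sum _ (fun a _ => fc (x + a))))//.
by rewrite big_const_seq count_predT iter_addr addr0 mulr_natr.
Qed.

Lemma avgN s f x : avg s (fun y => - f y) x = - avg s f x.
Proof. by rewrite /avg sumrN mulNr. Qed.

Lemma avg_ge s f c x : (0 < size s)%N -> (forall y, c <= f y) -> c <= avg s f x.
Proof.
move=> s0 fc; rewrite -lerN2 -avgN; apply: avg_le => // y.
by rewrite lerN2.
Qed.

Lemma avgD s f g x : avg s (fun y => f y + g y) x = avg s f x + avg s g x.
Proof. by rewrite /avg big_split mulrDl. Qed.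

Lemma avgZ s c f x : avg s (fun y => c * f y) x = c * avg s f x.
Proof. by rewrite /avg -mulr_sumr mulrA. Qed.

Lemma avg_norm_le s f c x : (0 < size s)%N ->
  (forall y, `|f y| <= c) -> `|avg s f x| <= c.
Proof.
move=> s0 fc; rewrite ler_norml avg_ge ?avg_le// => y.
  by have := fc y; rewrite ler_norml => /andP[].
by have := fc y; rewrite ler_norml => /andP[].
Qed.

Lemma avg_shift s f x y : avg s (fun z => f (y + z)) x = avg s f (y + x).
Proof. by rewrite /avg; under [in RHS]eq_bigr do rewrite -addrA. Qed.

Lemma avg_comm s t f x : avg s (avg t f) x = avg t (avg s f) x.
Proof.
rewrite /avg -!mulr_suml exchange_big /= mulrAC.
by under eq_bigr do under eq_bigr do rewrite addrAC.
Qed.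

Definition sumset s t := [seq a + b | a <- s, b <- t].

Lemma size_sumset_gt0 s t :
  (0 < size s)%N -> (0 < size t)%N -> (0 < size (sumset s t))%N.
Proof. by move=> s0 t0; rewrite size_allpairs muln_gt0 s0. Qed.

Lemma avg_sumset s t f x : avg (sumset s t) f x = avg s (avg t f) x.
Proof.
rewrite /avg big_allpairs_dep size_allpairs natrM invfM mulrA -mulr_suml.
rewrite mulrAC; congr (_ / _ / _).
by apply: eq_bigr => a _; apply: eq_bigr => b _; rewrite addrA.
Qed.

(** Averaging over a finite set [s] that meets every translate of a small
    neighbourhood shrinks the oscillation of [f] by a fixed amount: unless the
    lower bound [I] can be raised, every average has a term close to [I].  The set
    [s] stays the same throughout, as averaging preserves the modulus of
    continuity. *)
Lemma flatten_average s (e : R) N f I : (0 < size s)%N -> 0 < e ->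
  (forall x, exists2 b, b \in s & forall y, `|f (x - b + y) - f y| <= e) ->
  (forall x, I <= f x <= I + 4 * e + N%:R * (e / (size s)%:R)) ->
  exists t J, (0 < size t)%N /\ forall x, J <= avg t f x <= J + 4 * e.
Proof.
move=> s0 e0; have n0 := size_gt0R s0; set n := (size s)%:R in n0 *.
have d0 : 0 < e / n by exact: divr_gt0.
have de : e / n <= e.
  by rewrite ler_pdivrMr// ler_peMr ?(ltW e0)// /n ler1n.
elim: N f I => [|N ih] f I fmod fI.
  exists [:: 0], I; split => // x; rewrite /avg big_seq1 addr0 divr1.
  by have := fI x; rewrite mul0r addr0.
have [[w fw]|now] := pselect (exists w, f w <= I + e); last first.
  apply: (ih _ (I + e)) => // x; have := fI x; rewrite -natr1 mulrDl mul1r.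
  have : I + e < f x by rewrite ltNge; apply/negP => ?; apply: now; exists x.
  by move=> ? /andP[_ ?]; apply/andP; split; lra.
have [||t [J [t0 tJ]]] := ih (avg s f) I; last first.
- exists (sumset t s), J; split; first exact: size_sumset_gt0.
  by move=> x; rewrite avg_sumset.
- move=> x; apply/andP; split; first by apply: avg_ge => // y; case/andP: (fI y).
  have [b bs hb] := fmod (w - x).
  have fxb : f (x + b) <= I + 2 * e.
    have := hb (x + b); rewrite -[w - x - b]addrA -opprD subrK.
    by rewrite ler_norml => /andP[]; lra.
  set D := 4 * e + N.+1%:R * (e / n) in fI *.
  have D4 : 4 * e <= D by rewrite lerDl mulr_ge0 // ltW.
  rewrite -addrA in fI.
  have fD y : f y <= I + D by have /andP[] := fI y.
  rewrite /avg (big_rem b)//= ler_pdivrMr//.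
  have : \sum_(a <- rem b s) f (x + a) <= (n - 1) * (I + D).
    rewrite (le_trans (ler_sum _ (fun a _ => fD (x + a))))//.
    rewrite big_const_seq count_predT iter_addr addr0 size_rem// -mulr_natl.
    by rewrite /n -[in leRHS](prednK s0) -natr1 addrK.
  have -> : I + 4 * e + N%:R * (e / n) = I + D - e / n.
    by rewrite /D -natr1 mulrDl mul1r; lra.
  move=> h; rewrite mulrBl divfK ?gt_eqF//; nra.
- move=> x; have [b bs hb] := fmod x; exists b => // y.
  rewrite -avg_shift -avgN -avgD; exact: avg_norm_le.
Qed.

End Averages.

Section Mean.
Variables (R : realType) (X : topologicalZmodType).
Hypothesis X_compact : compact [set: X].
Implicit Types (f g : X -> R) (s t : seq X) (x y a b : X).

(** The least upper bound achievable by finite averages of translates; on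
    continuous functions it is the integral against Haar measure. *)
Definition mean f : R :=
  inf [set r | exists2 s, (0 < size s)%N & forall x, avg s f x <= r].

Lemma average_osc f e : continuous f -> 0 < e ->
  exists s c, (0 < size s)%N /\ forall x, `|avg s f x - c| <= e.
Proof.
move=> cf e0; pose e' := e / 4.
have e'0 : 0 < e' by rewrite divr_gt0.
have [s hs] := finite_translates X_compact (continuous_unif_cont X_compact cf e'0).
have s0 : (0 < size s)%N by case: s hs => // /(_ 0)[].
have [M fM] := continuous_bounded X_compact cf.
(* [2 * M] bounds the oscillation of [f]; each averaging removes [e' / size s]. *)
pose N := (Num.truncn (2 * M / (e' / (size s)%:R))).+1.
have d0 : 0 < e' / (size s)%:R by rewrite divr_gt0 ?size_gt0R.
have NM : 2 * M < N%:R * (e' / (size s)%:R).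
  by rewrite -ltr_pdivrMr// truncnS_gt.
have [||t [J [t0 tJ]]] := @flatten_average _ _ s e' N f (- M) s0 e'0.
- by [].
- move=> x; have := fM x; rewrite ler_norml => /andP[-> h] /=; lra.
exists t, J; split => // x; have /andP[h1 h2] := tJ x.
by rewrite ger0_norm ?subr_ge0// lerBlDl (le_trans h2)// lerD2l /e'; lra.
Qed.

Lemma mean_approx f e : continuous f -> 0 < e ->
  exists2 s, (0 < size s)%N & forall x, `|avg s f x - mean f| <= e.
Proof.
move=> cf e0; have e2 : 0 < e / 2 by rewrite divr_gt0.
have [s [c [s0 sc]]] := average_osc cf e2.
exists s => // x.
have lb r : [set r | exists2 s, (0 < size s)%N & forall x, avg s f x <= r] r ->
    c - e / 2 <= r.
  move=> [t t0 tr].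
  have h1 : avg s (avg t f) 0 <= r by exact: avg_le.
  rewrite avg_comm in h1; apply: le_trans h1; apply: avg_ge => // y.
  by have := sc y; rewrite ler_norml => /andP[]; lra.
have mc : `|mean f - c| <= e / 2.
  rewrite ler_norml; apply/andP; split.
    rewrite lerBrDl; apply: lb_le_inf; last by move=> r /lb.
    exists (c + e / 2); exists s => // y.
    by have := sc y; rewrite ler_norml => /andP[]; lra.
  rewrite lerBlDl; apply: ge_inf; first by exists (c - e / 2) => r /lb.
  exists s => // y.
  by have := sc y; rewrite ler_norml => /andP[]; lra.
rewrite -(subrKA c) (le_trans (ler_normD _ _))// [leRHS](splitr e).
by rewrite lerD// distrC.
Qed.

Lemma mean_unique f c : continuous f ->
  (forall e, 0 < e -> exists2 s, (0 < size s)%N & forall x, `|avg s f x - c| <= e) ->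
  mean f = c.
Proof.
move=> cf h; apply/eqP; rewrite -subr_eq0 -normr_le0.
apply/ler_addgt0Pr => e e0; rewrite add0r.
have e2 : 0 < e / 2 by rewrite divr_gt0.
have [s s0 hs] := mean_approx cf e2; have [t t0 ht] := h _ e2.
have h1 : `|avg t (avg s f) 0 - mean f| <= e / 2.
  rewrite -[avg _ _ _ - _]/(avg t (avg s f) 0 - mean f).
  have -> : avg t (avg s f) 0 - mean f = avg t (fun x => avg s f x - mean f) 0.
    rewrite avgD; congr (_ + _).
    apply: le_anti; apply/andP; split; [exact: avg_ge|exact: avg_le].
  exact: avg_norm_le.
have h2 : `|avg t (avg s f) 0 - c| <= e / 2.
  have -> : avg t (avg s f) 0 - c = avg s (fun x => avg t f x - c) 0.
    rewrite avgD avg_comm; congr (_ + _).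
    apply: le_anti; apply/andP; split; [exact: avg_ge|exact: avg_le].
  exact: avg_norm_le.
rewrite -(subrKA (avg t (avg s f) 0)) (le_trans (ler_normD _ _))// [leRHS](splitr e).
by rewrite lerD// distrC.
Qed.

Lemma mean_cst c : mean (fun=> c) = c.
Proof.
apply: mean_unique => [x|e e0]; first exact: cvg_cst.
exists [:: 0] => // x; rewrite /avg big_seq1 divr1 subrr normr0; exact: ltW.
Qed.

Lemma meanD f g : continuous f -> continuous g ->
  mean (fun x => f x + g x) = mean f + mean g.
Proof.
move=> cf cg; apply: mean_unique => [x|e e0].
  by apply: cvgD; [exact: cf|exact: cg].
have e2 : 0 < e / 2 by rewrite divr_gt0.
have [s s0 hs] := mean_approx cf e2; have [t t0 ht] := mean_approx cg e2.
exists (sumset s t); first exact: size_sumset_gt0.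
move=> x; rewrite avgD !avg_sumset avg_comm.
have cst u c : (0 < size u)%N -> avg u (fun=> - c) x = - c.
  move=> u0; apply: le_anti; apply/andP; split; [exact: avg_le|exact: avg_ge].
have -> : avg t (avg s f) x + avg s (avg t g) x - (mean f + mean g) =
    avg t (fun x => avg s f x - mean f) x + avg s (fun x => avg t g x - mean g) x.
  by rewrite !avgD !cst// opprD addrACA.
rewrite (le_trans (ler_normD _ _))// [leRHS](splitr e) lerD//; exact: avg_norm_le.
Qed.

Lemma meanZ c f : continuous f -> mean (fun x => c * f x) = c * mean f.
Proof.
move=> cf; apply: mean_unique => [x|e e0].
  by apply: cvgM; [exact: cvg_cst|exact: cf].
have d0 : 0 < e / (`|c| + 1) by rewrite divr_gt0// ltr_wpDl.
have [s s0 hs] := mean_approx cf d0; exists s => // x.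
rewrite avgZ -mulrBr normrM (le_trans (ler_wpM2l _ (hs x)))// mulrA.
rewrite ler_pdivrMr ?ltr_wpDl// mulrC ler_wpM2l ?ltW//; lra.
Qed.

Lemma mean_sum (I : Type) (r : seq I) (F : I -> X -> R) :
  (forall i, continuous (F i)) ->
  mean (fun x => \sum_(i <- r) F i x) = \sum_(i <- r) mean (F i).
Proof.
move=> cF; elim: r => [|i r ih].
  rewrite big_nil -[RHS](mean_cst 0); congr mean.
  by apply/funext => x; rewrite big_nil.
rewrite big_cons -ih -meanD//; last exact: continuous_sum.
by congr mean; apply/funext => x; rewrite big_cons.
Qed.

Lemma mean_ge0 f : continuous f -> (forall x, 0 <= f x) -> 0 <= mean f.
Proof.
move=> cf f0; apply/ler_addgt0Pr => e e0.
have [s s0 hs] := mean_approx cf e0.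
have := avg_ge 0 s0 f0; have := hs 0; rewrite ler_norml => /andP[]; lra.
Qed.

Lemma mean_le f g : continuous f -> continuous g -> (forall x, f x <= g x) ->
  mean f <= mean g.
Proof.
move=> cf cg fg; rewrite -subr_ge0 -mulN1r -meanZ// -meanD//; last first.
  by move=> x; apply: cvgM; [exact: cvg_cst|exact: cf].
apply: mean_ge0 => x; last by rewrite mulN1r subr_ge0.
by apply: cvgD; [exact: cg|apply: cvgM; [exact: cvg_cst|exact: cf]].
Qed.

Lemma mean_norm_le f c : continuous f -> (forall x, `|f x| <= c) -> `|mean f| <= c.
Proof.
move=> cf fc; have cc d : continuous (fun _ : X => d : R).
  by move=> x; exact: cvg_cst.
have h x : - c <= f x <= c by rewrite -ler_norml.
rewrite ler_norml; apply/andP; split.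
  by rewrite -{1}(mean_cst (- c)); apply: mean_le => // x; case/andP: (h x).
by rewrite -(mean_cst c); apply: mean_le => // x; case/andP: (h x).
Qed.

Lemma mean_shift f a : continuous f -> mean (fun x => f (a + x)) = mean f.
Proof.
move=> cf; have caf : continuous (fun x => f (a + x)).
  by move=> x; apply: (@cvg_comp _ _ _ (fun y => a + y) f);
    [exact: continuous_addl|exact: cf].
apply: mean_unique => // e e0; have [s s0 hs] := mean_approx cf e0.
by exists s => // x; rewrite avg_shift.
Qed.

(** Finitely many translates of the set where [f] is bounded away from [0]
    cover the group. *)
Lemma mean_gt0 f x : continuous f -> (forall y, 0 <= f y) -> 0 < f x -> 0 < mean f.
Proof.
move=> cf f0 fx.
have fx2 : 0 < f x / 2 by rewrite divr_gt0.
have cU : nbhs 0 [set u | f x / 2 <= f (u + x)].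
  have := continuous_unif_cont X_compact cf fx2; apply: filterS => u /(_ x).
  by rewrite ler_norml => /andP[] /=; lra.
have [s hs] := finite_translates X_compact cU.
have s0 : (0 < size s)%N by case: s hs => // /(_ 0)[].
have cs b : continuous (fun y => f (- b + x + y)).
  by move=> y; apply: (@cvg_comp _ _ _ (fun y => _ + y) f);
    [exact: continuous_addl|exact: cf].
have : f x / 2 <= mean (fun y => \sum_(b <- s) f (- b + x + y)).
  rewrite -{1}(mean_cst (f x / 2)); apply: mean_le => [y||y].
  - exact: cvg_cst.
  - exact: continuous_sum.
  have [b bs /= hb] := hs y; rewrite (big_rem b)//= addrAC [- b + y]addrC.
  by rewrite (le_trans hb)// lerDl sumr_ge0.
rewrite mean_sum//; under eq_bigr do rewrite mean_shift//.
rewrite big_const_seq count_predT iter_addr addr0 => h.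
have : 0 < mean f *+ size s by exact: lt_le_trans h.
by rewrite pmulrn_lgt0.
Qed.

End Mean.
(** * Extreme points *)

Section KreinMilman.

Lemma chain_compact_meet (T : topologicalType) (K : set T) (C : set (set T)) :
  compact K -> total_on C subset -> C !=set0 ->
  (forall F, C F -> [/\ closed F, F `<=` K & F !=set0]) ->
  exists p, forall F, C F -> F p.
Proof.
move=> cK tot [F0 CF0] hC.
have fF : Filter (filter_from C id).
  apply: filter_from_filter; first by exists F0.
  move=> F G CF CG; have [FG|GF] := tot _ _ CF CG.
    by exists F => // x Fx; split => //; exact: FG.
  by exists G => // x Gx; split => //; exact: GF.
have pF : ProperFilter (filter_from C id).
  by apply: filter_from_proper => F /hC[].
have [] := cK _ pF; first by exists F0 => //; have [] := hC _ CF0.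
move=> p [_ clp]; exists p => F CF; have [cF _ _] := hC _ CF.
by apply: cF => U pU; apply: clp => //; exists F.
Qed.

Variables (R : realType) (T : Type).
Implicit Types (K F : set {ptws T -> R}) (f g h : {ptws T -> R}).

Lemma ptws_eval_continuous (x : T) : continuous (fun f : {ptws T -> R} => f x).
Proof. exact: (@proj_continuous {classic T} (fun=> R) x). Qed.

Lemma closed_continuous_ge (S : topologicalType) (L : S -> R) (c : R) :
  continuous L -> closed [set f | c <= L f].
Proof.
move=> cL; apply: (@closed_comp _ _ L [set r | c <= r]); last exact: closed_ge.
by move=> y _; exact: cL.
Qed.

Definition mix (t : R) f g : {ptws T -> R} := fun x => t * f x + (1 - t) * g x.

Definition is_face K F := [/\ F `<=` K, closed F, F !=set0 &
  forall t f g, 0 < t < 1 -> K f -> K g -> F (mix t f g) -> F f /\ F g].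

(** A minimal closed face is a single point: otherwise some coordinate is not
    constant on it, and the points where that coordinate is maximal form a
    smaller face. *)
Lemma face_extreme K F0 : compact K -> is_face K F0 ->
  exists f, F0 f /\
    forall t g h, 0 < t < 1 -> K g -> K h -> f = mix t g h -> g = f.
Proof.
move=> cK [F0K clF0 F0ne F0f].
have [C CP tot|A [PA maxA]] := @Zorn_bigcup _ [set U | is_face K (F0 `\` U)].
  have [C0|/set0P Cne] := eqVneq C set0.
    by rewrite /= C0 bigcup_set0 setD0.
  have E : F0 `\` \bigcup_(U in C) U = \bigcap_(U in C) (F0 `\` U).
    apply/seteqP; split => [x [Fx nU] U CU|x h].
      by split => // Ux; apply: nU; exists U.
    have [U CU] := Cne; have [Fx _] := h U CU; split => // -[V CV Vx].
    by have [_] := h V CV.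
  rewrite /= E; split.
  - by move=> x h; have [U CU] := Cne; have [/F0K] := h U CU.
  - by apply: closed_bigI => U /CP[].
  - have [|||p hp] :=
      @chain_compact_meet _ K [set F0 `\` U | U in C] cK.
    + move=> _ _ [U CU <-] [V CV <-]; have [UV|VU] := tot _ _ CU CV; [right|left].
        exact: setDS.
      exact: setDS.
    + by have [U CU] := Cne; exists (F0 `\` U), U.
    + by move=> _ [U /CP[? ? ? _] <-].
    by exists p => U CU; apply: hp; exists U.
  - move=> t f g t01 Kf Kg h; split => U CU.
      by have [_ _ _ /(_ t f g t01 Kf Kg (h U CU))[]] := CP _ CU.
    by have [_ _ _ /(_ t f g t01 Kf Kg (h U CU))[]] := CP _ CU.
set F := F0 `\` A in PA.
have min G : is_face K G -> G `<=` F -> G = F.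
  move=> fG GF; apply/seteqP; split => // x Fx; apply: contrapT => nGx.
  apply: (maxA (~` G)); last first.
    suff : is_face K (F0 `\` ~` G) by [].
    by rewrite setDE setCK setIidr// => y /GF[].
  split; first by move=> y Ay /GF[].
  by move=> h; have [_] := Fx; apply; exact: h.
have [FK clF Fne Ff] := PA.
have single f g : F f -> F g -> f = g.
  suff val x : exists M, forall f, F f -> f x = M.
    by move=> Ff1 Fg; apply/funext => x; have [M hM] := val x; rewrite !hM.
  have cF : compact F by exact: (subclosed_compact _ cK).
  have [c /set_mem Fc maxc] := @compact_EVT_max _ R (fun f => f x) F Fne cF
    (continuous_subspaceT (@ptws_eval_continuous x)).
  exists (c x) => f1 Ff1.
  pose G := F `&` [set f : {ptws T -> R} | c x <= f x].
  have GE : G = F.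
    apply: min; last by move=> y [].
    split.
    - by move=> y [/FK].
    - apply: closedI => //.
      exact: (@closed_continuous_ge {ptws T -> R} (fun f => f x) (c x)
        (@ptws_eval_continuous x)).
    - by exists c; split => /=.
    move=> t f2 g2 /andP[t0 t1] Kf2 Kg2 [Fm cm].
    have [Ff2 Fg2] := Ff _ _ _ (introT andP (conj t0 t1)) Kf2 Kg2 Fm.
    have h1 := maxc _ (mem_set Ff2); have h2 := maxc _ (mem_set Fg2).
    by move: cm; rewrite /= /mix => cm; split; split => //=; nra.
  have [_ /= h] : G f1 by rewrite GE.
  by apply: le_anti; rewrite h andbT maxc ?inE.
have [f Fx] := Fne; exists f; split; first by case: Fx.
move=> t g h t01 Kg Kh E; apply: single => //.
by have [] : F g /\ F h by apply: (Ff t) => //; rewrite -E.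
Qed.

End KreinMilman.
(** * Positive definite functions *)

Section PositiveDefinite.
Variables (R : realType) (X : zmodType).
Implicit Types (f g : X -> R) (s t : seq X) (x y a b : X).

(** Positive definiteness on the discrete group underlying [X]: continuity is not
    required, so that the normalized functions form a compact set for pointwise
    convergence. *)
Definition posdef f := (forall x, f (- x) = f x) /\
  forall s : seq (R * X), 0 <= \sum_(p <- s) \sum_(q <- s) p.1 * q.1 * f (p.2 - q.2).

Lemma posdef_norm_le f x : posdef f -> `|f x| <= f 0.
Proof.
move=> [ev pf].
have h (e : R) : e ^+ 2 = 1 -> 0 <= f 0 + e * f x.
  move=> e2; have := pf [:: (1, x); (e, 0)].
  rewrite !big_cons !big_nil /= !subrr subr0 sub0r ev.
  by rewrite !(mul1r, mulr1, addr0) -expr2 e2 mul1r; lra.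
have := h 1; have := h (-1); rewrite sqrrN expr1n mul1r mulN1r.
by move=> /(_ erefl) h1 /(_ erefl) h2; rewrite ler_norml; apply/andP; split; lra.
Qed.

Lemma posdefZ (c : R) f : 0 <= c -> posdef f -> posdef (fun x => c * f x).
Proof.
move=> c0 [ev pf]; split => [x|s]; first by rewrite ev.
have -> : \sum_(p <- s) \sum_(q <- s) p.1 * q.1 * (c * f (p.2 - q.2)) =
    c * \sum_(p <- s) \sum_(q <- s) p.1 * q.1 * f (p.2 - q.2).
  rewrite mulr_sumr; apply: eq_bigr => p _; rewrite mulr_sumr.
  by apply: eq_bigr => q _; rewrite mulrCA.
exact: mulr_ge0.
Qed.

(** On the Fourier side, [f] is multiplied by [2 + 2 * e * re (chi a)] at each
    character [chi], which is nonnegative. *)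
Lemma posdef_split f a (e : R) : e ^+ 2 = 1 -> posdef f ->
  posdef (fun x => 2 * f x + e * (f (x + a) + f (x - a))).
Proof.
move=> e2 [ev pf]; split => [x|s].
  rewrite ev [f (x + a) + _]addrC; congr (_ + _ * (_ + _)).
    by rewrite -ev opprD opprK addrC.
  by rewrite -ev opprD !opprK.
have := pf (s ++ [seq (e * p.1, p.2 + a) | p <- s]).
rewrite big_cat /= big_map /= -big_split /=.
move=> /le_trans; apply; rewrite le_eqVlt; apply/orP; left; apply/eqP.
apply: eq_bigr => p _.
rewrite !big_cat /= !big_map /= -!big_split /=; apply: eq_bigr => q _.
have -> : p.2 + a - (q.2 + a) = p.2 - q.2 by rewrite opprD addrACA subrr addr0.
have -> : p.2 + a - q.2 = p.2 - q.2 + a by rewrite addrAC.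
have -> : p.2 - (q.2 + a) = p.2 - q.2 - a by rewrite opprD addrA.
transitivity (p.1 * q.1 * ((1 + e ^+ 2) * f (p.2 - q.2) +
  e * (f (p.2 - q.2 + a) + f (p.2 - q.2 - a)))); last by rewrite e2.
by ring.
Qed.

(** For a positive definite [f], the infimum of these averages is the mass at the
    trivial character of the measure whose Fourier transform is [f]. *)
Definition energy s f : R :=
  (\sum_(x <- s) \sum_(y <- s) f (x - y)) / (size s)%:R ^+ 2.

Lemma energyD s f g : energy s (fun x => f x + g x) = energy s f + energy s g.
Proof.
rewrite /energy -mulrDl -big_split; congr (_ / _).
by apply: eq_bigr => x _; rewrite -big_split.
Qed.

Lemma energyZ s c f : energy s (fun x => c * f x) = c * energy s f.
Proof.
rewrite /energy mulrA mulr_sumr; congr (_ / _).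
by apply: eq_bigr => x _; rewrite mulr_sumr.
Qed.

(** Apply positive definiteness to the points of [s] with weight [1] and their
    translates by [c] with weight [-1]. *)
Lemma posdef_sum_shift f s c : posdef f ->
  \sum_(x <- s) \sum_(y <- s) f (x - y + c) <= \sum_(x <- s) \sum_(y <- s) f (x - y).
Proof.
move=> [ev pf].
have := pf ([seq (1, x) | x <- s] ++ [seq (-1, x + c) | x <- s]).
rewrite big_cat /= !big_map /=.
set A := \sum_(x <- s) \sum_(y <- s) f (x - y).
set B := \sum_(x <- s) \sum_(y <- s) f (x - y + c).
have -> : \sum_(i <- s) \sum_(q <- [seq (1, x) | x <- s] ++ [seq (-1, x + c) | x <- s])
    1 * q.1 * f (i - q.2) = A - B.
  have -> : B = \sum_(x <- s) \sum_(y <- s) f (y - x + c) by exact: exchange_big.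
  rewrite -sumrB; apply: eq_bigr => x _.
  rewrite big_cat !big_map /= -sumrN; congr (_ + _); apply: eq_bigr => y _.
    by rewrite !mul1r.
  by rewrite mul1r mulN1r -[in RHS]ev !opprD !opprK addrA [- y + _]addrC.
have -> : \sum_(i <- s) \sum_(q <- [seq (1, x) | x <- s] ++ [seq (-1, x + c) | x <- s])
    -1 * q.1 * f (i + c - q.2) = A - B.
  rewrite -sumrB; apply: eq_bigr => x _.
  rewrite big_cat !big_map /= addrC -sumrN; congr (_ + _); apply: eq_bigr => y _.
    by rewrite mulN1r opprK mul1r opprD addrACA subrr addr0.
  by rewrite mulr1 mulN1r addrAC.
by lra.
Qed.

(** The average over [sumset s t] is an average, over differences [c] of points of
    [t], of shifted averages over [s]. *)
Lemma energy_sumset f s t : posdef f -> (0 < size s)%N -> (0 < size t)%N ->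
  energy (sumset s t) f <= energy s f.
Proof.
move=> pf s0 t0; rewrite /energy size_allpairs natrM exprMn.
have s0R : 0 < (size s)%:R ^+ 2 :> R by rewrite exprn_gt0 ?size_gt0R.
have t0R : 0 < (size t)%:R ^+ 2 :> R by rewrite exprn_gt0 ?size_gt0R.
rewrite ler_pdivrMr ?(mulr_gt0 s0R t0R)// mulrA divfK ?gt_eqF//.
rewrite big_allpairs_dep /=.
under eq_bigr do under eq_bigr do rewrite big_allpairs_dep /=.
rewrite exchange_big /=.
under eq_bigr do under eq_bigr do rewrite exchange_big /=.
under eq_bigr do rewrite exchange_big /=.
under eq_bigr do under eq_bigr do under eq_bigr do under eq_bigr do
  rewrite opprD addrACA.
rewrite (le_trans (ler_sum _ (fun p _ => ler_sum _ (fun q _ =>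
  posdef_sum_shift s (p - q) pf))))//.
by rewrite !big_const_seq !count_predT !iter_addr !addr0
  -natrX mulr_natr -mulrnA mulnn.
Qed.

Lemma energy_sumsetC f s t : energy (sumset s t) f = energy (sumset t s) f.
Proof.
rewrite /energy !size_allpairs mulnC; congr (_ / _).
rewrite !big_allpairs_dep /= exchange_big /=.
apply: eq_bigr => p _; apply: eq_bigr => q _.
rewrite !big_allpairs_dep /= exchange_big /=.
by apply: eq_bigr => p' _; apply: eq_bigr => q' _; rewrite [q + _]addrC [q' + _]addrC.
Qed.

Lemma energy_avg s f : energy s f = avg s (fun y => avg s f (- y)) 0.
Proof.
rewrite /energy /avg exchange_big /= -mulr_suml -mulrA -invfM -expr2.
congr (_ / _); apply: eq_bigr => y _; apply: eq_bigr => x _.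
by rewrite add0r addrC.
Qed.

Lemma energy_pair s u f :
  energy (sumset s [:: 0; u]) f =
  energy s (fun d => (2 * f d + f (d + u) + f (d - u)) / 4).
Proof.
have num : \sum_(x <- sumset s [:: 0; u]) \sum_(y <- sumset s [:: 0; u]) f (x - y) =
    \sum_(x <- s) \sum_(y <- s) (2 * f (x - y) + f (x - y + u) + f (x - y - u)).
  rewrite big_allpairs_dep; apply: eq_bigr => x _.
  rewrite !big_cons big_nil !big_allpairs_dep /= !addr0 -big_split /=.
  apply: eq_bigr => y _; rewrite !big_cons !big_nil !addr0.
  have -> : x + u - (y + u) = x - y by rewrite opprD addrACA subrr addr0.
  have -> : x + u - y = x - y + u by rewrite addrAC.
  have -> : x - (y + u) = x - y - u by rewrite opprD addrA.
  by ring.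
rewrite /energy num size_allpairs /= natrM exprMn invfM mulrA mulrAC.
have -> : 2 ^+ 2 = 4 :> R by ring.
congr (_ / _); rewrite mulr_suml; apply: eq_bigr => x _.
by rewrite mulr_suml.
Qed.

End PositiveDefinite.

(** * Autocorrelations and extreme positive definite functions *)

Section Kernel.
Variables (R : realType) (X : topologicalZmodType).
Hypothesis X_compact : compact [set: X].
Implicit Types (f g : X -> R) (s t : seq X) (x y a b : X).

(** The autocorrelation of [g], whose Fourier transform is nonnegative. *)
Definition kernel g x : R := mean (fun y => g (y + x) * g y).

Lemma continuous_shift g x : continuous g -> continuous (fun y => g (y + x)).
Proof.
move=> cg y; apply: (@cvg_comp _ _ _ (fun y => y + x) g); last exact: cg.
exact: continuous_addr.
Qed.

Lemma kernelB g x y : continuous g ->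
  kernel g (x - y) = mean (fun z => g (z + x) * g (z + y)).
Proof.
move=> cg; rewrite /kernel.
rewrite -(@mean_shift _ _ X_compact (fun z => g (z + (x - y)) * g z) y).
  congr mean; apply/funext => z; rewrite [y + z]addrC.
  by congr (g _ * g _); rewrite -addrA [y + _]addrC subrK.
by apply: continuousM_fun => //; exact: continuous_shift.
Qed.

(** The Schur product theorem for a positive definite function and an
    autocorrelation. *)
Lemma posdefM_kernel f g : continuous g -> posdef f ->
  posdef (fun x => f x * kernel g x).
Proof.
move=> cg [ev pf]; split => [x|s].
  rewrite ev; congr (_ * _); rewrite -[- x]add0r kernelB//.
  by congr mean; apply/funext => y; rewrite addr0 mulrC.
have cgg x y : continuous (fun z => g (z + x) * g (z + y)).
  by apply: continuousM_fun; exact: continuous_shift.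
have ccgg c x y : continuous (fun z => c * (g (z + x) * g (z + y))).
  by apply: continuousM_fun => [z|]; [exact: cvg_cst|exact: cgg].
have -> : \sum_(p <- s) \sum_(q <- s) p.1 * q.1 * (f (p.2 - q.2) * kernel g (p.2 - q.2)) =
    mean (fun z => \sum_(p <- s) \sum_(q <- s)
      p.1 * q.1 * f (p.2 - q.2) * (g (z + p.2) * g (z + q.2))).
  rewrite mean_sum//; last by move=> p; apply: continuous_sum => q.
  apply: eq_bigr => p _; rewrite mean_sum//; apply: eq_bigr => q _.
  by rewrite kernelB// mulrA meanZ.
apply: mean_ge0 => //.
  by apply: continuous_sum => p; apply: continuous_sum => q.
move=> z; have := pf [seq (p.1 * g (z + p.2), p.2) | p <- s].
rewrite big_map => /le_trans; apply; rewrite le_eqVlt; apply/orP; left; apply/eqP.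
by apply: eq_bigr => p _; rewrite big_map; apply: eq_bigr => q _ /=; ring.
Qed.

Lemma posdef1 : posdef (fun _ : X => 1 : R).
Proof.
split => // s.
have -> : \sum_(p <- s) \sum_(q <- s) p.1 * q.1 * 1 = (\sum_(p <- s) p.1) ^+ 2.
  rewrite expr2 mulr_suml; apply: eq_bigr => p _; rewrite mulr_sumr.
  by apply: eq_bigr => q _; rewrite mulr1.
exact: sqr_ge0.
Qed.

Lemma posdef_kernel g : continuous g -> posdef (kernel g).
Proof.
move=> cg; have := posdefM_kernel cg posdef1.
by congr posdef; apply/funext => x; rewrite mul1r.
Qed.

Lemma kernel_unif_cont g : continuous g -> unif_cont (kernel g).
Proof.
move=> cg e e0; have [M gM] := continuous_bounded X_compact cg.
have M0 : 0 <= M by rewrite (le_trans _ (gM 0)).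
have d0 : 0 < e / (M + 1) by rewrite divr_gt0// ltr_wpDl.
apply: filterS (continuous_unif_cont X_compact cg d0) => u hu x.
rewrite /kernel -mulN1r -meanZ//; last first.
  by apply: continuousM_fun => //; exact: continuous_shift.
rewrite -meanD//; first last.
- apply: continuousM_fun => [y|]; first exact: cvg_cst.
  by apply: continuousM_fun => //; exact: continuous_shift.
- by apply: continuousM_fun => //; exact: continuous_shift.
apply: mean_norm_le => // [|y].
  move=> y; apply: cvgD; [|apply: cvgM; [exact: cvg_cst|]];
  by apply: continuousM_fun => //; exact: continuous_shift.
rewrite mulN1r -mulrBl normrM addrCA.
apply: (le_trans (ler_pM (normr_ge0 _) (normr_ge0 _) (hu _) (gM y))).
by rewrite mulrAC ler_pdivrMr ?ltr_wpDl// ler_wpM2l ?(ltW e0)// lerDl.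
Qed.

(** Averaging [f] over differences of points of a sumset can be arranged to give
    nearly the mean of [f], and only decreases the energy. *)
Lemma energy_ge_mean f s : continuous f -> posdef f -> (0 < size s)%N ->
  mean f <= energy s f.
Proof.
move=> cf pf s0; apply/ler_addgt0Pr => e e0.
have [t t0 ht] := mean_approx X_compact cf e0.
rewrite -lerBlDr (le_trans _ (energy_sumset pf s0 t0))// energy_avg.
apply: avg_ge; first exact: size_sumset_gt0.
move=> y; rewrite avg_sumset; apply: avg_ge => // z.
by have := ht z; rewrite ler_norml => /andP[]; lra.
Qed.

End Kernel.

Section ExtremePositiveDefinite.
Variables (R : realType) (X : topologicalZmodType).
Hypothesis X_compact : compact [set: X].
Implicit Types (f g h : {ptws X -> R}) (t : R) (s r : seq X) (x y a b : X).

Definition normalized_posdef : set {ptws X -> R} :=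
  [set f | posdef (f : X -> R) /\ f 0 = 1].

Lemma closure_ge (S : topologicalType) (L : S -> R) (A : set S) (f : S) :
  continuous L -> (forall h : S, A h -> 0 <= L h) -> closure A f -> 0 <= L f.
Proof.
move=> cL AL; have cl := @closed_continuous_ge _ _ _ 0 cL.
by move=> Af; apply: cl; apply: closure_subset Af.
Qed.

Lemma closure_eq0 (S : topologicalType) (L : S -> R) (A : set S) (f : S) :
  continuous L -> (forall h : S, A h -> L h = 0) -> closure A f -> L f = 0.
Proof.
move=> cL L0 Af; apply: le_anti; apply/andP; split; last first.
  by apply: (closure_ge cL _ Af) => h /L0 ->.
rewrite -oppr_ge0; apply: (@closure_ge _ (fun h : S => - L h) _ _ _ _ Af).
  by move=> h; apply: cvgN; exact: cL.
by move=> h /L0 ->; rewrite oppr0.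
Qed.

Lemma normalized_posdef_closed : closed normalized_posdef.
Proof.
have ev := @ptws_eval_continuous R X.
move=> f clf.
have eq0 (L : {ptws X -> R} -> R) : continuous L ->
    (forall h, normalized_posdef h -> L h = 0) -> L f = 0.
  by move=> cL L0; exact: (@closure_eq0 {ptws X -> R} L normalized_posdef f).
split; first split.
- move=> x; apply/eqP; rewrite -subr_eq0; apply/eqP.
  apply: (eq0 (fun h => h (- x) - h x)).
    exact: continuousB_fun (ev (- x)) (ev x).
  by move=> h [[evh _] _]; rewrite evh subrr.
- move=> s; apply: (@closure_ge _ (fun h : {ptws X -> R} =>
    \sum_(p <- s) \sum_(q <- s) p.1 * q.1 * h (p.2 - q.2)) _ _ _ _ clf).
    apply: continuous_sum => p; apply: continuous_sum => q.
    exact: continuousM_fun (@continuous_cst_fun _ _ _) (ev _).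
  by move=> h [[_ ph] _]; exact: ph.
- apply/eqP; rewrite -subr_eq0; apply/eqP; apply: (eq0 (fun h => h 0 - 1)).
    exact: continuousB_fun (ev 0) (@continuous_cst_fun _ _ 1).
  by move=> h [_ ->]; rewrite subrr.
Qed.

Lemma normalized_posdef_compact : compact normalized_posdef.
Proof.
have cube : @compact {ptws X -> R} [set f | forall x, -1 <= f x <= 1].
  apply: (@tychonoff {classic X} (fun=> R) (fun=> [set r | -1 <= r <= 1])) => x.
  have -> : [set r : R | -1 <= r <= 1] = `[-1, 1]%classic.
    by apply/seteqP; split => r /=; rewrite in_itv.
  exact: segment_compact.
apply: subclosed_compact normalized_posdef_closed cube _.
move=> f [pf f0] x /=; rewrite -ler_norml -f0.
exact: posdef_norm_le.
Qed.

Definition extreme_posdef f := normalized_posdef f /\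
  forall t g h, 0 < t < 1 -> normalized_posdef g -> normalized_posdef h ->
    f = mix t g h -> g = f.

Lemma energy_continuous k s :
  continuous (fun f : {ptws X -> R} => energy s (fun x => f x * k x)).
Proof.
have ev := @ptws_eval_continuous R X.
apply: continuousM_fun; last exact: continuous_cst_fun.
apply: continuous_sum => x; apply: continuous_sum => y.
exact: continuousM_fun (ev (x - y)) (@continuous_cst_fun _ _ _).
Qed.

(** Maximize over [f] the infimum of the energies of [f * k].  This infimum is an
    upper semicontinuous function of [f], so the maximum is attained; it is also
    affine, because enlarging a finite set lowers the energies of any two positive
    definite functions at once.  So the maximizers form a face. *)
Lemma extreme_maximizer (u : X -> R) : continuous u -> 0 < kernel u 0 ->
  let k := kernel u in
  exists f th, [/\ extreme_posdef f, 0 < th,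
    forall s, (0 < size s)%N -> th <= energy s (fun x => f x * k x) &
    forall e, 0 < e -> exists2 s, (0 < size s)%N &
      energy s (fun x => f x * k x) <= th + e].
Proof.
move=> cu k00 k.
have ck : continuous k by apply: unif_cont_continuous; exact: kernel_unif_cont.
have pk : posdef k by exact: posdef_kernel.
pose low (c : R) : set {ptws X -> R} := [set f | normalized_posdef f /\
  forall s, (0 < size s)%N -> c <= energy s (fun x => f x * k x)].
pose T : set R := [set c | low c !=set0].
(* [k / k 0] itself shows that the supremum is positive. *)
pose th := sup T.
have lowk : T (mean (fun x => k x * k x) / k 0).
  exists (fun x => (k 0)^-1 * k x); split.
    split; last by rewrite mulVf// gt_eqF.
    by apply: posdefZ => //; rewrite invr_ge0 ltW.
  move=> s s0; have -> : (fun x => (k 0)^-1 * k x * k x) =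
      (fun x => (k 0)^-1 * (k x * k x)) by apply/funext => x; rewrite mulrA.
  rewrite energyZ mulrC ler_wpM2l ?invr_ge0 ?(ltW k00)//.
  apply: energy_ge_mean => //; first exact: continuousM_fun.
  exact: posdefM_kernel.
have T_ub : ubound T (k 0).
  move=> r [f [[_ f0] /(_ [:: 0] isT)]].
  by rewrite /energy !big_seq1 subrr f0 mul1r expr1n divr1.
have T_sup : has_sup T by split; [eexists; exact: lowk|exists (k 0)].
have th0 : 0 < th.
  apply: lt_le_trans (ub_le_sup T_sup.2 lowk); rewrite divr_gt0//.
  apply: (@mean_gt0 _ _ _ _ 0) => //; first exact: continuousM_fun.
    by move=> y; rewrite -expr2 sqr_ge0.
  by rewrite mulr_gt0.
have low_mono (r r' : R) : r <= r' -> low r' `<=` low r.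
  by move=> rr f [Pf h]; split => // s /h; exact: le_trans.
have low_closed (r : R) : closed (low r).
  have -> : low r = normalized_posdef `&`
      \bigcap_(s in [set s : seq X | (0 < size s)%N])
        [set f : {ptws X -> R} | r <= energy s (fun x => f x * k x)].
    by apply/seteqP; split.
  apply: closedI; first exact: normalized_posdef_closed.
  apply: closed_bigI => s _; apply: closed_continuous_ge.
  exact: energy_continuous.
have small f e : normalized_posdef f -> 0 < e -> exists2 s, (0 < size s)%N &
    energy s (fun x => f x * k x) <= th + e.
  move=> Pf e0; apply: contrapT => h.
  have : T (th + e).
    exists f; split => // s s0; apply: ltW; rewrite ltNge; apply/negP => hs.
    by apply: h; exists s.
  move/(ub_le_sup T_sup.2); rewrite -/th; lra.
have lowth : low th !=set0.
  have [|||f hf] := @chain_compact_meet _ normalized_posdef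
      [set low c | c in T] normalized_posdef_compact.
  - move=> _ _ [r _ <-] [r' _ <-]; have [rr|rr] := leP r r'; [right|left].
      exact: low_mono.
    by apply: low_mono; exact: ltW.
  - by eexists; eexists; first exact: lowk.
  - by move=> _ [r Tr <-]; split => //; move=> f [].
  have lowf (r : R) : T r -> low r f by move=> Tr; apply: hf; exists r.
  exists f; split; first by have [] := lowf _ lowk.
  move=> s s0; apply: ge_sup; first by eexists; exact: lowk.
  by move=> r /lowf[_]; exact.
have [f [[Pf hf] exf]] : exists f, low th f /\
    forall t g h, 0 < t < 1 -> normalized_posdef g -> normalized_posdef h ->
      f = mix t g h -> g = f.
  apply: (face_extreme normalized_posdef_compact); split => //.
    by move=> f [].
  suff half t f g : 0 < t < 1 -> normalized_posdef f -> normalized_posdef g ->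
      low th (mix t f g) -> low th f.
    move=> t f g t01 Pf Pg h; split; first exact: (half t _ g).
    apply: (half (1 - t) _ f) => //.
      by move: t01 => /andP[? ?]; apply/andP; split; lra.
    suff -> : mix (1 - t) g f = mix t f g by [].
    by apply/funext => x; rewrite /mix subKr addrC.
  move=> /andP[t0 t1] Pf Pg [_ h]; split => // s s0; rewrite leNgt; apply/negP => hs.
  set E := energy s _ in hs.
  have e0 : 0 < t * (th - E) by rewrite mulr_gt0// subr_gt0.
  have [r r0 hr] := small g _ Pg e0.
  have pfk : posdef (fun x => f x * k x) by apply: posdefM_kernel => //; case: Pf.
  have pgk : posdef (fun x => g x * k x) by apply: posdefM_kernel => //; case: Pg.
  have := h _ (size_sumset_gt0 s0 r0).
  have -> : (fun x => mix t f g x * k x) =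
      (fun x => t * (f x * k x) + (1 - t) * (g x * k x)).
    by apply/funext => x; rewrite /mix mulrDl !mulrA.
  rewrite energyD !energyZ.
  have h1 := energy_sumset pfk s0 r0; have h2 := energy_sumset pgk r0 s0.
  rewrite energy_sumsetC in h2; rewrite -/E in h1.
  have : t * energy (sumset s r) (fun x => f x * k x) <= t * E.
    by rewrite ler_wpM2l// ltW.
  have : (1 - t) * energy (sumset s r) (fun x => g x * k x) <=
      (1 - t) * (th + t * (th - E)).
    by rewrite ler_wpM2l ?(le_trans h2)//; lra.
  move=> A B C.
  have : 0 < t * (t * (th - E)) by exact: mulr_gt0.
  by nra.
exists f, th; split => // e e0; exact: small.
Qed.

End ExtremePositiveDefinite.
(** * From d'Alembert's equation to characters *)

Section DAlembert.
Variables (R : realType) (X : topologicalZmodType).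
Implicit Types (x y a b u : X).

Definition dalembert (f : X -> R) :=
  f 0 = 1 /\ forall x a, f (x + a) + f (x - a) = 2 * f x * f a.

(** If neither [g 0] nor [h 0] vanishes, normalizing [g] and [h] writes [f] as a
    proper convex combination; if one of them vanishes, so does that summand. *)
Lemma extreme_summand (f : {ptws X -> R}) (g h : X -> R) : extreme_posdef f ->
  posdef g -> posdef h -> (forall x, g x + h x = f x) -> forall x, g x = g 0 * f x.
Proof.
move=> [[pf f0] ex] pg ph gh x.
have g0 : 0 <= g 0 by rewrite (le_trans _ (posdef_norm_le 0 pg)).
have h0 : 0 <= h 0 by rewrite (le_trans _ (posdef_norm_le 0 ph)).
have gh0 : g 0 + h 0 = 1 by rewrite gh.
have [g00|/eqP g00] := eqVneq (g 0) 0.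
  have := posdef_norm_le x pg; rewrite g00 normr_le0 mul0r => /eqP; exact.
have [h00|/eqP h00] := eqVneq (h 0) 0.
  have := posdef_norm_le x ph; rewrite h00 normr_le0 => /eqP hx.
  have -> : g 0 = 1 by lra.
  by rewrite mul1r -gh hx addr0.
have gp : 0 < g 0 by rewrite lt_neqAle g0 andbT eq_sym; exact/eqP.
have hp : 0 < h 0 by rewrite lt_neqAle h0 andbT eq_sym; exact/eqP.
have E := ex (g 0) (fun x => (g 0)^-1 * g x) (fun x => (h 0)^-1 * h x).
rewrite -{1}E; first by rewrite mulVKf// gt_eqF.
- by apply/andP; split; lra.
- by split; [apply: posdefZ => //; rewrite invr_ge0|rewrite mulVf// gt_eqF].
- by split; [apply: posdefZ => //; rewrite invr_ge0|rewrite mulVf// gt_eqF].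
apply/funext => y; rewrite /mix -gh.
have -> : 1 - g 0 = h 0 by lra.
by rewrite !mulVKf// gt_eqF.
Qed.

(** By [posdef_split], [f] is half the sum of the two functions
    [f +- (f (. + a) + f (. - a)) / 2], both positive definite. *)
Lemma extreme_dalembert (f : {ptws X -> R}) : extreme_posdef f -> dalembert f.
Proof.
move=> exf; have [[pf f0] _] := exf; split => // x a.
pose g e x := 4^-1 * (2 * f x + e * (f (x + a) + f (x - a))).
have pg e : e ^+ 2 = 1 -> posdef (g e : X -> R).
  by move=> e2; apply: posdefZ; rewrite ?invr_ge0//; exact: posdef_split.
have [ev _] := pf.
have h y : g 1 y + g (-1) y = f y by rewrite /g; field.
have := extreme_summand exf (pg 1 _) (pg (-1) _) h x.
rewrite sqrrN expr1n => /(_ erefl erefl).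
rewrite /g add0r sub0r ev f0 !mul1r; lra.
Qed.

Lemma dalembert_even f : dalembert f -> forall x, f (- x) = f x.
Proof. by move=> [f0 df] x; have := df 0 x; rewrite add0r sub0r f0; lra. Qed.

Lemma dalembert_prod f x y : dalembert f ->
  f (x + y) * f (x - y) = f x ^+ 2 + f y ^+ 2 - 1.
Proof.
move=> [f0 df]; have := df (x + y) (x - y).
have -> : x + y + (x - y) = x + x by rewrite addrACA subrr addr0.
have -> : x + y - (x - y) = y + y.
  by rewrite opprB [x + y]addrC addrACA subrr addr0.
have := df x x; have := df y y; rewrite !subrr f0 !expr2; lra.
Qed.

(** Both sides are the square of [sin x * sin y] when [f] is [cos]. *)
Lemma dalembert_sqr f x y : dalembert f ->
  (f (x + y) - f x * f y) ^+ 2 = (1 - f x ^+ 2) * (1 - f y ^+ 2).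
Proof.
move=> Df; have := dalembert_prod x y Df; have [_ df] := Df.
by have := df x y; nra.
Qed.

Lemma dalembert_norm_le f x : posdef f -> dalembert f -> `|f x| <= 1.
Proof. by move=> pf [<- _]; exact: posdef_norm_le. Qed.

(** A function [f] of this kind is [cos], and [f (x - a) - f (x + a)] is a nonzero
    multiple of [sin] whenever [f a] is not [1] or [-1]; the addition formulas for the two
    are formal consequences of the equation for [f]. *)
Lemma dalembert_character f : posdef f -> dalembert f -> unif_cont f ->
  exists2 chi : {ptws X -> circle R}, dual chi & forall x, re (chi x) = f x.
Proof.
move=> pf Df uf; have [f0 df] := Df; have ev := dalembert_even Df.
suff [g [gf ga fa]] : exists g : X -> R, [/\ forall x, f x ^+ 2 + g x ^+ 2 = 1,
    forall x y, g (x + y) = g x * f y + f x * g y &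
    forall x y, f (x + y) = f x * f y - g x * g y].
  pose chi : {ptws X -> circle R} := fun x => s2val (circle_ex (gf x)).
  have reE x : re (chi x) = f x by exact: (s2valP (circle_ex (gf x))).
  have imE x : im (chi x) = g x by exact: (s2valP' (circle_ex (gf x))).
  have chiD x y : chi (x + y) = chi x + chi y.
    by apply: circle_inj; rewrite ?reD ?imD !reE !imE ?fa ?ga// addrC.
  exists chi => //; split => // x U /nbhs_circleP[e e0 eU].
  have e2 : 0 < e ^+ 2 / 4 by rewrite divr_gt0// exprn_gt0.
  apply/(nbhs_shift x); apply: filterS (uf _ e2) => u /= /(_ 0) hu.
  apply: eU; rewrite chiD addrK -(@ltr_pXn2r _ 2)// ?nnegrE ?gauge_ge0 ?(ltW e0)//.
  rewrite gauge2 reE; move: hu; rewrite addr0 f0 ler_norml => /andP[]; lra.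
have [[a fa1]|all1] := pselect (exists a, f a ^+ 2 <> 1); last first.
  have {}all1 a : f a ^+ 2 = 1 by apply: contrapT => h; apply: all1; exists a.
  exists (fun=> 0); split => [x|x y|x y].
  - by rewrite all1 expr0n addr0.
  - by rewrite mul0r mulr0 addr0.
  - have := dalembert_sqr x y Df; rewrite !all1 subrr mul0r => /eqP.
    by rewrite sqrf_eq0 subr_eq0 => /eqP ->; rewrite subr0.
pose sa := Num.sqrt (1 - f a ^+ 2).
have fa2 : f a ^+ 2 < 1.
  rewrite lt_neqAle; apply/andP; split; first exact/eqP.
  by rewrite -real_normK ?num_real// expr_le1// dalembert_norm_le.
have sa0 : 0 < sa by rewrite sqrtr_gt0 subr_gt0.
have sa2 : sa ^+ 2 = 1 - f a ^+ 2 by rewrite sqr_sqrtr// subr_ge0 ltW.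
have prod x y : (f (x - a) - f (x + a)) * (f (y - a) - f (y + a)) =
    2 * sa ^+ 2 * (f (x - y) - f (x + y)).
  have := df (x - a) (y - a); have := df (x - a) (y + a).
  have := df (x + a) (y - a); have := df (x + a) (y + a).
  have -> : x + a + (y + a) = x + y + (a + a) by rewrite addrACA.
  have -> : x + a - (y + a) = x - y by rewrite opprD addrACA subrr addr0.
  have -> : x + a + (y - a) = x + y by rewrite addrACA subrr addr0.
  have -> : x + a - (y - a) = x - y + (a + a) by rewrite opprB [a - y]addrC addrACA.
  have -> : x - a + (y + a) = x + y by rewrite addrACA addNr addr0.
  have -> : x - a - (y + a) = x - y - (a + a) by rewrite !opprD addrACA.
  have -> : x - a + (y - a) = x + y - (a + a) by rewrite opprD addrACA.
  have -> : x - a - (y - a) = x - y by rewrite opprB addrA subrK.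
  have := df (x + y) (a + a); have := df (x - y) (a + a).
  have := df a a; rewrite subrr f0 sa2; nra.
exists (fun x => (f (x - a) - f (x + a)) / (2 * sa)).
have prod' x y : (f (x - a) - f (x + a)) / (2 * sa) *
    ((f (y - a) - f (y + a)) / (2 * sa)) = (f (x - y) - f (x + y)) / 2.
  by rewrite mulrACA prod; field; rewrite gt_eqF.
have fD x y : f (x + y) = f x * f y - (f (x - a) - f (x + a)) / (2 * sa) *
    ((f (y - a) - f (y + a)) / (2 * sa)).
  by rewrite prod'; have := df x y; lra.
split => [x|x y|x y]; last exact: fD.
- by rewrite [X in _ + X]expr2 prod' subrr f0; have := df x x; rewrite subrr f0; lra.
- apply: (@mulIf _ (2 * sa)); first by rewrite mulf_neq0// gt_eqF.
  rewrite divfK ?mulf_neq0 ?gt_eqF// mulrDl mulrAC divfK ?mulf_neq0 ?gt_eqF//.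
  rewrite -mulrA divfK ?mulf_neq0 ?gt_eqF//.
  have := df (x - a) y; have := df (x + a) y; have := df (y - a) x; have := df (y + a) x.
  have -> : x - a + y = x + y - a by rewrite addrAC.
  have -> : x - a - y = - (y - x + a) by rewrite opprD opprB addrAC.
  have -> : x + a + y = x + y + a by rewrite addrAC.
  have -> : x + a - y = - (y - x - a) by rewrite opprD opprB opprK addrAC.
  have -> : y - a + x = x + y - a by rewrite addrAC [y + x]addrC.
  have -> : y - a - x = y - x - a by rewrite addrAC.
  have -> : y + a + x = x + y + a by rewrite addrAC [y + x]addrC.
  have -> : y + a - x = y - x + a by rewrite addrAC.
  by rewrite !ev; lra.
Qed.

End DAlembert.
(** * Continuous characters separate points *)

Section Separation.
Variables (R : realType) (X : topologicalZmodType).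
Hypotheses (X_hausdorff : hausdorff_space X) (X_compact : compact [set: X]).
Implicit Types (x y a b u : X) (s : seq X).

(** Compare the energy over [s] with the energy over [s] and its translate by a
    small [u]: by d'Alembert's equation the second is about [(1 + f u) / 2] times
    the first.  Since the infimum [th] is positive, [f u] is close to [1]. *)
Lemma energy_unif_cont (f k : X -> R) (th : R) : unif_cont k ->
  posdef f -> dalembert f -> 0 < th ->
  (forall s, (0 < size s)%N -> th <= energy s (fun x => f x * k x)) ->
  (forall e, 0 < e -> exists2 s, (0 < size s)%N &
    energy s (fun x => f x * k x) <= th + e) ->
  unif_cont f.
Proof.
move=> uk pf Df th0 lo hi e e0; have [f0 df] := Df.
(* With [1 - f u <= d], [e / 2] bounds both [f x * (1 - f u)] and, in absolute
   value, [f (x + u) - f x * f u], whose square is at most [1 - f u ^+ 2]. *)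
pose d := Num.min (e ^+ 2 / 8) (e / 2).
have d0 : 0 < d by rewrite lt_min !divr_gt0// exprn_gt0.
have hd : 0 < th * d by exact: mulr_gt0.
apply: filterS (uk _ hd) => u hu x.
have fu : 1 - f u <= d.
  rewrite -(ler_pM2l th0); apply/ler_addgt0Pr => c c0.
  have c2 : 0 < c / 2 by rewrite divr_gt0.
  have [s s0 hs] := hi _ c2.
  have := lo _ (size_sumset_gt0 (s := s) (t := [:: 0; u]) s0 isT).
  rewrite energy_pair => h.
  have : energy s (fun y => (2 * (f y * k y) + f (y + u) * k (y + u) +
      f (y - u) * k (y - u)) / 4) <=
      energy s (fun y => (1 + f u) / 2 * (f y * k y) + th * d / 2).
    rewrite /energy ler_pM2r ?invr_gt0 ?exprn_gt0 ?size_gt0R//.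
    apply: ler_sum => p _; apply: ler_sum => q _; set y := p - q.
    have fn z := dalembert_norm_le z pf Df.
    have k1 : `|k (y + u) - k y| <= th * d by rewrite [y + u]addrC.
    have k2 : `|k (y - u) - k y| <= th * d.
      by have := hu (y - u); rewrite [u + _]addrC subrK distrC.
    have b1 : `|f (y + u) * (k (y + u) - k y)| <= th * d.
      by rewrite normrM -[leRHS]mul1r ler_pM.
    have b2 : `|f (y - u) * (k (y - u) - k y)| <= th * d.
      by rewrite normrM -[leRHS]mul1r ler_pM.
    move: b1 b2; rewrite !ler_norml => /andP[_ b1] /andP[_ b2].
    have := df y u; nra.
  rewrite energyD energyZ.
  have -> : energy s (fun=> th * d / 2) = th * d / 2.
    rewrite /energy !big_const_seq !count_predT !iter_addr !addr0 -mulrnA mulnn.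
    by rewrite -(mulr_natr (th * d / 2)) natrX mulfK// gt_eqF// exprn_gt0// size_gt0R.
  have := dalembert_norm_le u pf Df; rewrite ler_norml => /andP[fu1 fu2].
  have : (1 + f u) / 2 * energy s (fun x => f x * k x) <= (1 + f u) / 2 * (th + c / 2).
    by rewrite ler_wpM2l//; lra.
  have : 0 <= (1 - f u) * c by rewrite mulr_ge0 ?subr_ge0// ltW.
  by move: h; lra.
have fn z := dalembert_norm_le z pf Df.
have fu2 : (f (x + u) - f x * f u) ^+ 2 <= (e / 2) ^+ 2.
  rewrite dalembert_sqr//.
  have : d <= e ^+ 2 / 8 by rewrite ge_min lexx.
  have := fn x; have := fn u; rewrite !ler_norml => /andP[a1 a2] /andP[b1 b2].
  have : 0 <= (1 - f x ^+ 2) <= 1.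
    by rewrite subr_ge0 gerBl sqr_ge0 -real_normK ?num_real// expr_le1// fn.
  have : 0 <= 1 - f u ^+ 2 <= 2 * d by apply/andP; split; nra.
  move=> /andP[c1 c2] /andP[d1 d2] ed.
  rewrite (le_trans (_ : _ <= 1 * (2 * d)))//; first exact: ler_pM.
  by rewrite mul1r exprMn exprVn; nra.
have {}fu2 : `|f (x + u) - f x * f u| <= e / 2.
  by rewrite -(@ler_pXn2r _ 2)// ?nnegrE ?divr_ge0 ?(ltW e0)// real_normK ?num_real.
have : `|f x * f u - f x| <= e / 2.
  have -> : f x * f u - f x = f x * (f u - 1) by ring.
  rewrite normrM -[leRHS]mul1r ler_pM// distrC ger0_norm.
    by rewrite (le_trans fu)// ge_min lexx orbT.
  by have := fn u; rewrite ler_norml => /andP[]; lra.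
move=> h; rewrite [u + x]addrC -(subrKA (f x * f u)) (le_trans (ler_normD _ _))//.
by rewrite [leRHS](splitr e) lerD.
Qed.

(** If [f x0 = 1], then [f] is constant on the multiples of [x0], so the energies
    over long stretches of multiples are the mean squares of telescoping sums. *)
Lemma energy_nontrivial (f g : X -> R) (x0 : X) (th : R) :
  continuous g -> dalembert f -> 0 < th ->
  (forall s, (0 < size s)%N ->
    th <= energy s (fun x => f x * kernel (fun y => g y - g (y + x0)) x)) ->
  f x0 <> 1.
Proof.
move=> cg Df th0 lo fx0; have [f0 df] := Df.
have per x : f (x + x0) = f x.
  have := dalembert_sqr x x0 Df; rewrite fx0 expr1n subrr mulr0 mulr1 => /eqP.
  by rewrite sqrf_eq0 subr_eq0 => /eqP.
have perMn x n : f (x + x0 *+ n) = f x.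
  by elim: n => [|n ih]; rewrite ?mulr0n ?addr0// mulrSr addrA per.
have fB i j : f (x0 *+ i - x0 *+ j) = 1.
  by rewrite -(perMn _ j) subrK -[_ *+ i]add0r perMn.
have [M gM] := continuous_bounded X_compact cg.
set g' := fun y => g y - g (y + x0) in lo.
have cg' : continuous g' by apply: continuousB_fun => //; exact: continuous_shift.
have tele N z : \sum_(i <- iota 0 N) g' (z + x0 *+ i) = g z - g (z + x0 *+ N).
  elim: N => [|N ih]; first by rewrite big_nil mulr0n addr0 subrr.
  rewrite -addn1 iotaD big_cat ih big_seq1 add0n /g' addn1 mulrSr addrA.
  by rewrite /= subrKA.
have bound N : (0 < N)%N -> th * N%:R ^+ 2 <= 4 * M ^+ 2.
  move=> N0; have := lo [seq x0 *+ i | i <- iota 0 N].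
  rewrite size_map size_iota => /(_ N0).
  rewrite /energy size_map size_iota ler_pdivlMr ?exprn_gt0 ?ltr0n// => /le_trans.
  apply.
  have cc i j : continuous (fun z => g' (z + x0 *+ i) * g' (z + x0 *+ j)).
    by apply: continuousM_fun; exact: continuous_shift.
  have -> : \sum_(x <- [seq x0 *+ i | i <- iota 0 N])
      \sum_(y <- [seq x0 *+ i | i <- iota 0 N]) f (x - y) * kernel g' (x - y) =
      mean (fun z => (\sum_(i <- iota 0 N) g' (z + x0 *+ i)) ^+ 2).
    have -> : (fun z => (\sum_(i <- iota 0 N) g' (z + x0 *+ i)) ^+ 2) =
        fun z => \sum_(i <- iota 0 N) \sum_(j <- iota 0 N)
          g' (z + x0 *+ i) * g' (z + x0 *+ j).
      apply/funext => z; rewrite expr2 mulr_suml; apply: eq_bigr => i _.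
      by rewrite mulr_sumr.
    rewrite mean_sum//; last by move=> i; apply: continuous_sum => j.
    rewrite big_map; apply: eq_bigr => i _.
    rewrite mean_sum// big_map; apply: eq_bigr => j _.
    by rewrite fB mul1r kernelB.
  rewrite -(mean_cst X_compact (4 * M ^+ 2)); apply: mean_le => //.
  - have cs : continuous (fun z => \sum_(i <- iota 0 N) g' (z + x0 *+ i)).
      by apply: continuous_sum => i; exact: continuous_shift.
    exact: (continuousM_fun cs cs).
  - exact: continuous_cst_fun.
  move=> z; rewrite tele.
  have := gM z; have := gM (z + x0 *+ N); rewrite !ler_norml.
  by move=> /andP[? ?] /andP[? ?]; nra.
pose N := (Num.truncn (4 * M ^+ 2 / th)).+1.
have : 4 * M ^+ 2 / th < N%:R by exact: truncnS_gt.
rewrite ltr_pdivrMr// => h; have := bound N isT.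
have : 1 <= N%:R :> R by rewrite ler1n.
by nra.
Qed.

(** Urysohn's lemma gives a continuous [g] with [g 0 <> g x0]; the extreme maximizer
    for the autocorrelation of [g - g (. + x0)] is the real part of a continuous
    character that is not trivial at [x0]. *)
Theorem characters_separate x0 : x0 <> 0 -> exists2 chi, @dual R X chi & chi x0 <> 0.
Proof.
move=> x00.
have [g [cg gx]] : exists g : X -> R, continuous g /\ g 0 <> g x0.
  have nX : normal_space X by exact: compact_normal.
  have cl1 := accessible_closed_set1 (hausdorff_accessible X_hausdorff).
  have := (@normal_separatorP R X).1 nX _ _ (cl1 0) (cl1 x0).
  have -> : [set (0 : X)] `&` [set x0] = set0.
    by apply/seteqP; split => // y [/= -> /esym].
  move=> /(_ erefl); rewrite (@uniform_separatorP X R) => -[g [cg _ g0 g1]].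
  exists g; split; first exact: cg.
  have -> : g 0 = 0 by apply: g0; exists 0.
  have -> : g x0 = 1 by apply: g1; exists x0.
  by move/eqP; rewrite eq_sym oner_eq0.
pose g' y := g y - g (y + x0).
have cg' : continuous g' by apply: continuousB_fun => //; exact: continuous_shift.
have k0 : 0 < kernel g' 0.
  apply: (@mean_gt0 _ _ X_compact _ 0).
  - apply: continuousM_fun => //; exact: continuous_shift.
  - by move=> y; rewrite addr0 -expr2 sqr_ge0.
  rewrite !addr0 -expr2 exprn_even_gt0//= /g' add0r subr_eq0; exact/eqP.
have [f [th [exf th0 lo hi]]] := extreme_maximizer X_compact cg' k0.
have Df := extreme_dalembert exf; have [[pf _] _] := exf.
have uf := energy_unif_cont (kernel_unif_cont X_compact cg') pf Df th0 lo hi.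
have [chi dchi rechi] := dalembert_character pf Df uf.
exists chi => // chi0; apply: (energy_nontrivial cg Df th0 lo).
by rewrite -rechi chi0 re0.
Qed.

End Separation.
(** * Small values of characters *)

Lemma history_choice (T : Type) (P : seq T -> T -> Prop) :
  (forall h, exists t, P h t) -> exists u : nat -> T, forall n, P (mkseq u n) (u n).
Proof.
move=> /choice[f fP].
pose hist n := iter n (fun h => rcons h (f h)) [::].
exists (fun n => f (hist n)) => n.
suff -> : mkseq (fun n => f (hist n)) n = hist n by exact: fP.
by elim: n => // n ih; rewrite mkseqS ih.
Qed.

Lemma infinite_set_neq (T : choiceType) (S : set T) : infinite_set S ->
  exists x y, [/\ S x, S y & x <> y].
Proof.
move=> infS; have [x Sx] := infinite_setN0 infS.
have [y [Sy yx]] := infinite_setN0 (infinite_setD infS (finite_set1 x)).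
by exists x, y; split => // /esym.
Qed.

Section Pigeonhole.
Variable R : realType.

(** Cut the square that contains the circle into finitely many small cells. *)
Lemma pigeonhole1 (T : choiceType) (S : set T) (h : T -> circle R) (e : R) :
  infinite_set S -> 0 < e -> exists2 S', infinite_set S' &
    S' `<=` S /\ forall x y, S' x -> S' y -> gauge (h x - h y) < e.
Proof.
move=> infS e0.
pose N := (Num.truncn (2 / e)).+1.
have Ne : 2 / e < N%:R by exact: truncnS_gt.
have N0 : 0 < N%:R :> R by rewrite ltr0n.
pose cell (r : R) := Num.truncn ((r + 1) * N%:R).
have ge0 (r : R) : -1 <= r -> 0 <= (r + 1) * N%:R.
  by move=> r1; apply: mulr_ge0; [lra|exact: ltW].
have cell_le r : -1 <= r <= 1 -> (cell r < (2 * N).+1)%N.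
  move=> /andP[r1 r2]; rewrite ltnS -(ler_nat R) natrM.
  apply: (@le_trans _ _ ((r + 1) * N%:R)).
    by rewrite truncn_le ge0.
  by rewrite ler_pM2r//; lra.
have cell_eq r r' : -1 <= r -> -1 <= r' -> cell r = cell r' -> (r - r') ^+ 2 <= (e / 2) ^+ 2.
  move=> r1 r2 E.
  have rr (s : R) : -1 <= s -> (cell s)%:R <= (s + 1) * N%:R < (cell s)%:R + 1.
    by move=> s1; rewrite natr1 truncn_itv// ge0.
  have := rr r r1; have := rr r' r2; rewrite E => /andP[a1 a2] /andP[b1 b2].
  have : N%:R * `|r - r'| <= 1.
    by rewrite -{1}(ger0_norm (ltW N0)) -normrM ler_norml; apply/andP; split; lra.
  move: Ne; rewrite ltr_pdivrMr// => Ne h2.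
  rewrite -[(r - r') ^+ 2]real_normK ?num_real// ler_pXn2r ?nnegrE//; last by lra.
  have := normr_ge0 (r - r'); nra.
pose piece (ij : 'I_(2 * N).+1 * 'I_(2 * N).+1) := S `&` [set x |
  cell (re (h x)) = ij.1 :> nat /\ cell (im (h x)) = ij.2 :> nat].
have [[ij infp]|no] := pselect (exists ij, infinite_set (piece ij)).
  exists (piece ij) => //; split; first by move=> x [].
  move=> x y [_ [x1 x2]] [_ [y1 y2]].
  have h1 := cell_eq _ _ (re_geN1 (h x)) (re_geN1 (h y)) (etrans x1 (esym y1)).
  have /andP[i1 _] := im_itv (h x); have /andP[i2 _] := im_itv (h y).
  have h2 := cell_eq _ _ i1 i2 (etrans x2 (esym y2)).
  rewrite -(@ltr_pXn2r _ 2)// ?nnegrE ?gauge_ge0 ?(ltW e0)// gauge2 reB.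
  have := re2Dim2 (h x); have := re2Dim2 (h y); have := exprn_gt0 2 e0.
  move: h1 h2; rewrite !exprMn !exprVn; nra.
exfalso; apply: infS.
apply: (@sub_finite_set _ _ (\bigcup_(ij in [set: 'I_(2 * N).+1 * 'I_(2 * N).+1]) piece ij)).
  move=> x Sx; have hx : -1 <= re (h x) <= 1 by rewrite re_geN1 re_le1.
  by exists (Ordinal (cell_le _ hx), Ordinal (cell_le _ (im_itv (h x)))).
apply: bigcup_finite; first exact: finite_finset.
by move=> ij _; apply: contrapT => h'; apply: no; exists ij.
Qed.

Lemma pigeonhole (T : choiceType) (I : eqType) (l : seq I) (h : I -> T -> circle R)
    (S : set T) (e : R) : infinite_set S -> 0 < e ->
  exists2 S', infinite_set S' & S' `<=` S /\
    forall i x y, i \in l -> S' x -> S' y -> gauge (h i x - h i y) < e.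
Proof.
move=> infS e0; elim: l => [|i l [S1 inf1 [sub1 h1]]].
  by exists S => //; split.
have [S2 inf2 [sub2 h2]] := pigeonhole1 (h i) inf1 e0.
exists S2 => //; split; first exact: subset_trans sub2 sub1.
move=> j x y; rewrite inE => /orP[/eqP-> Sx Sy|jl Sx Sy]; first exact: h2.
by apply: h1 => //; exact: sub2.
Qed.

Variable X : topologicalZmodType.
Implicit Types (phi psi chi : {ptws X -> circle R}).

Lemma dualB phi psi : dual phi -> dual psi -> dual (phi - psi).
Proof.
move=> [cphi mphi] [cpsi mpsi]; split; last first.
  move=> x y; rewrite [LHS]/(phi (x + y) - psi (x + y)).
  by rewrite mphi mpsi opprD addrACA.
move=> x; apply: (@continuous2_cvg _ (circle R) (circle R) (circle R) (nbhs x) _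
  phi psi (fun y z => y - z) (phi x) (psi x)).
- exact: (@sub_continuous (circle R) (phi x, psi x)).
- exact: cphi.
- exact: cpsi.
Qed.

Lemma dual_val0 phi : dual phi -> phi 0 = 0.
Proof.
by move=> [_ m]; apply: (addIr (phi 0)); rewrite add0r -m addr0.
Qed.

Lemma dual_valN phi x : dual phi -> phi (- x) = - phi x.
Proof.
move=> dphi; have [_ m] := dphi; apply/eqP.
by rewrite -addr_eq0 -m addNr dual_val0.
Qed.

Lemma dual_valB phi x y : dual phi -> phi (x - y) = phi x - phi y.
Proof. by move=> dphi; have [_ m] := dphi; rewrite m dual_valN. Qed.

Lemma dual_valMn phi x n : dual phi -> phi (x *+ n) = phi x *+ n.
Proof.
move=> dphi; have [_ m] := dphi; elim: n => [|n ih]; first exact: dual_val0.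
by rewrite !mulrS m ih.
Qed.

Lemma dual_Mn phi n : dual phi -> dual (phi *+ n).
Proof.
move=> dphi; elim: n => [|n ih].
  by rewrite mulr0n -(subrr phi); exact: dualB.
have -> : phi *+ n.+1 = phi - (phi *+ n - phi *+ n - phi *+ n).
  by rewrite subrr sub0r opprK mulrS.
by apply: dualB => //; apply: dualB => //; exact: dualB.
Qed.

Lemma ptws_val_Mn phi n x : (phi *+ n) x = phi x *+ n.
Proof. by elim: n => // n ih; rewrite !mulrS -ih. Qed.

Lemma dual_nbhs0 phi (e : R) : dual phi -> 0 < e ->
  nbhs 0 [set x | gauge (phi x) < e].
Proof.
move=> dphi e0; have [c _] := dphi; have := c 0.
rewrite /continuous_at dual_val0// => /(_ [set u | gauge u < e]); apply.
by apply/nbhs_circleP; exists e => // v; rewrite subr0.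
Qed.

Hypotheses (X_hausdorff : hausdorff_space X) (X_compact : compact [set: X]).

(** If there were only finitely many characters, some [z <> 0] would be nearly
    killed by all of them, hence, as their multiples are among them, killed. *)
Lemma dual_infinite : infinite_set [set: X] -> infinite_set (@dual R X).
Proof.
move=> infX /finite_seqP[l lE].
have inl phi : dual phi -> phi \in l by rewrite lE.
have [S infS [_ hS]] := @pigeonhole X _ l
  (fun (phi : {ptws X -> circle R}) x => phi x) _ 1 infX ltr01.
have [x [y [Sx Sy xy]]] := infinite_set_neq infS.
have [|chi dchi] := @characters_separate R X X_hausdorff X_compact (x - y).
  by move/eqP; rewrite subr_eq0 => /eqP.
apply; apply: no_small_subgroup => n.
rewrite -ptws_val_Mn dual_valB; last exact: dual_Mn.
by apply: hS => //; apply: inl; exact: dual_Mn.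
Qed.

End Pigeonhole.
(** * Convergence on a countable set and on a perfect set *)

Section CountableDual.
Variables (R : realType) (X : topologicalZmodType).
Hypotheses (X_hausdorff : hausdorff_space X) (X_compact : compact [set: X]).
Variable d : nat -> {ptws X -> circle R}.
Hypotheses (d_dual : forall n, dual (d n)) (d_inj : injective d).
Implicit Types (x y c : X) (phi chi : {ptws X -> circle R}).

Definition common_kernel : set X := [set x | forall n, d n x = 0].
Local Notation K := common_kernel.

Lemma common_kernel0 : K 0.
Proof. by move=> n; exact: dual_val0. Qed.

Lemma common_kernelB x y : K x -> K y -> K (x - y).
Proof. by move=> Kx Ky n; rewrite dual_valB// Kx Ky subrr. Qed.

Lemma gauge_le0 (u : circle R) : (forall e, 0 < e -> gauge u <= e) -> u = 0.
Proof.
move=> h; apply: gauge_eq0; apply: le_anti; rewrite gauge_ge0 andbT.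
by apply/ler_addgt0Pr => e e0; rewrite add0r h.
Qed.

(** A sequence on which every [d n] tends to the neutral element need not tend to
    [0] when [X] is not metrizable, but all its cluster points are in [K]. *)
Lemma frequently_near_kernel (x : nat -> X) (U : set X) (M : nat) :
  (forall n e, 0 < e -> exists N, forall m, (N <= m)%N -> gauge (d n (x m)) < e) ->
  nbhs 0 U -> exists m c, [/\ (M <= m)%N, K c & U (x m - c)].
Proof.
move=> xd U0; have [] := X_compact (F := x @ \oo); first exact: filterT.
move=> c [_ clc]; have Kc : K c.
  move=> n; apply: gauge_le0 => e e0.
  have e2 : 0 < e / 2 by rewrite divr_gt0.
  have [N hN] := xd n _ e2.
  have [_ [[m Nm <-] /= hm]] : x @` [set m | (N <= m)%N] `&`
      [set y | gauge (d n (y - c)) < e / 2] !=set0.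
    apply: clc.
      by apply: filterS (nbhs_infty_ge N) => m /= Nm; exists m.
    apply/(nbhs_shift c); have := dual_nbhs0 (d_dual n) e2.
    by apply: filterS => u /=; rewrite addrK.
  have := gaugeB (d n c) (d n (x m)); rewrite -dual_valB// => E.
  have := gaugeD (d n c - d n (x m)) (d n (x m)); rewrite subrK.
  have := hN m Nm; move: hm; rewrite !dual_valB// gaugeB; lra.
have [_ [[m Mm <-] /= hm]] : x @` [set m | (M <= m)%N] `&` [set y | U (y - c)] !=set0.
  apply: clc.
    by apply: filterS (nbhs_infty_ge M) => m /= Mm; exists m.
  by apply/(nbhs_shift c); apply: filterS U0 => u /=; rewrite addrK.
by exists m, c.
Qed.

Lemma small_nbhs (E : seq {ptws X -> circle R}) (e : R) :
  (forall phi, phi \in E -> dual phi) -> 0 < e ->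
  nbhs (0 : X) [set x | forall phi, phi \in E -> gauge (phi x) < e].
Proof.
move=> dE e0; elim: E dE => [|phi E ih] dE; first exact: filterS filterT.
have h1 : nbhs (0 : X) [set x | forall phi, phi \in E -> gauge (phi x) < e].
  by apply: ih => psi hpsi; apply: dE; rewrite inE hpsi orbT.
have h2 := dual_nbhs0 (dE phi (mem_head _ _)) e0.
apply: filterS2 h1 h2 => x hx1 hx2 psi; rewrite inE => /orP[/eqP-> //|].
exact: hx1.
Qed.

Lemma range_infinite : infinite_set (range d).
Proof.
move=> fin; apply: infinite_nat; rewrite -(@eq_finite_set _ _ (range d))//.
by apply: inj_card_eq => i j _ _; exact: d_inj.
Qed.

(** If the set where finitely many characters are small were inside [K], it would
    have finitely many translates covering [X] and two of the characters [d n]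
    would be uniformly close. *)
Lemma small_outside_kernel (E : seq {ptws X -> circle R}) (e : R) :
  (forall phi, phi \in E -> dual phi) -> 0 < e ->
  exists x, ~ K x /\ forall phi, phi \in E -> gauge (phi x) < e.
Proof.
move=> dE e0; apply: contrapT => no.
have sub x : (forall phi, phi \in E -> gauge (phi x) < e) -> K x.
  by move=> hx; apply: contrapT => nK; apply: no; exists x.
have W0 := small_nbhs dE e0.
have [F hF] := finite_translates X_compact W0.
have [S infS [Sd hS]] := @pigeonhole R _ X F (fun b (phi : {ptws X -> circle R}) => phi b)
  _ 1 range_infinite ltr01.
have [phi [psi [Si Sj]]] := infinite_set_neq infS.
have [i _ iE] := Sd _ Si; have [j _ jE] := Sd _ Sj; move: Si Sj.
rewrite -iE -jE => Si Sj; apply; apply/funext => z; apply/eqP; rewrite -subr_eq0; apply/eqP.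
apply: no_small_subgroup => n.
have -> : (d i z - d j z) *+ n = d i (z *+ n) - d j (z *+ n).
  by rewrite (dual_valMn z n (d_dual i)) (dual_valMn z n (d_dual j)) mulrnBl.
have [b bF /sub hb] := hF (z *+ n).
have eqb k : d k (z *+ n) = d k b.
  by have := hb k; rewrite dual_valB// => /eqP; rewrite subr_eq0 => /eqP.
by rewrite !eqb; apply: hS.
Qed.

(** Infinitely many of the [d n] are pairwise close on [Y]; subtract one of them
    from another. *)
Lemma fresh_small_character (Y : seq X) (l : seq {ptws X -> circle R}) (e : R) :
  0 < e -> exists phi, [/\ dual phi, forall x, K x -> phi x = 0,
    phi \notin l & forall y, y \in Y -> gauge (phi y) < e].
Proof.
move=> e0.
have [S infS [Sd hS]] := @pigeonhole R _ X Y (fun b (phi : {ptws X -> circle R}) => phi b)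
  _ e range_infinite e0.
have [psi Spsi] := infinite_setN0 infS.
have fin : finite_set [set phi + psi | phi in [set` l]].
  by apply: finite_image; exact: finite_seq.
have [phi [Sphi nphi]] := infinite_setN0 (infinite_setD infS fin).
have [i _ iE] := Sd _ Spsi; have [j _ jE] := Sd _ Sphi.
exists (phi - psi); split.
- by rewrite -iE -jE; exact: dualB.
- by move=> x Kx; rewrite -iE -jE; transitivity (d j x - d i x) => //; rewrite (Kx i) (Kx j) subrr.
- by apply/negP => h; apply: nphi; exists (phi - psi) => //; rewrite subrK.
- by move=> y yY; exact: hS.
Qed.

Local Notation eps n := ((4%:R^-1 : R) ^+ n).

(** The characters [e n] and points [a n] are chosen in turn, each one small
    against everything chosen before, so that [gauge (e k (a i))] is at most
    [2 ^- (k + i)] whatever the order of [k] and [i]. *)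
Lemma interleaved_choice (q : nat -> X) :
  exists (e : nat -> {ptws X -> circle R}) (a : nat -> X),
  [/\ injective e,
      forall n, dual (e n) /\ forall x, K x -> e n x = 0,
      forall n i, (i < n)%N -> gauge (e n (q i)) < eps n,
      forall n, ~ K (a n) &
      (forall n i, (i < n)%N -> gauge (d i (a n)) < eps n) /\
      forall k i, gauge (e k (a i)) <= 2%:R^-1 ^+ k * 2%:R^-1 ^+ i].
Proof.
(* [h] ranges over all histories, and [small_outside_kernel] applies only to those
   whose first components are characters. *)
pose P (h : seq ({ptws X -> circle R} * X)) (t : {ptws X -> circle R} * X) :=
  (dual t.1 /\ forall x, K x -> t.1 x = 0) /\
  ((forall p, p \in h -> dual p.1) ->
  [/\ t.1 \notin map fst h,
   forall y, y \in map snd h ++ mkseq q (size h) -> gauge (t.1 y) < eps (size h),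
   ~ K t.2 &
   forall phi, phi \in t.1 :: map fst h ++ mkseq d (size h) ->
     gauge (phi t.2) < eps (size h)]).
have ep n : 0 < eps n by rewrite exprn_gt0// invr_gt0.
have [u uP] : exists u, forall n, P (mkseq u n) (u n).
  apply: history_choice => h.
  have [phi [dphi phiK phi_new phi_small]] := fresh_small_character
    (map snd h ++ mkseq q (size h)) (map fst h) (ep (size h)).
  have [dh|ndh] := pselect (forall p, p \in h -> dual p.1); last first.
    by exists (phi, 0); split.
  have [|a [nKa ha]] := @small_outside_kernel
    (phi :: map fst h ++ mkseq d (size h)) (eps (size h)) _ (ep (size h)).
    move=> psi; rewrite inE mem_cat => /orP[/eqP-> //|/orP[/mapP[p ph ->]|]].
      exact: dh.
    by move=> /mapP[i _ ->].
  by exists (phi, a); split.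
exists (fun n => (u n).1), (fun n => (u n).2).
have duK n := (uP n).1; have du n := (duK n).1.
have hist n p : p \in mkseq u n -> dual p.1 by move=> /mapP[i _ ->].
have {}uP n := (uP n).2 (hist n).
have mem1 i n : (i < n)%N -> (u i).1 \in map fst (mkseq u n).
  by move=> lt_in; apply: map_f; apply: map_f; rewrite mem_iota.
have mem2 i n : (i < n)%N -> (u i).2 \in map snd (mkseq u n).
  by move=> lt_in; apply: map_f; apply: map_f; rewrite mem_iota.
have new i n : (i < n)%N -> (u n).1 <> (u i).1.
  move=> lt_in E; have [+ _ _ _] := uP n.
  by rewrite E mem1.
split.
- move=> i j E; apply/eqP; case: ltngtP => // lt_ij.
    by have := new _ _ lt_ij; rewrite E.
  by have := new _ _ lt_ij; rewrite E.
- exact: duK.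
- move=> n i lt_in; have [_ h _ _] := uP n; move: h; rewrite size_mkseq; apply.
  by rewrite mem_cat map_f ?orbT// mem_iota.
- by move=> n; have [] := uP n.
split.
- move=> n i lt_in; have [_ _ _ h] := uP n; move: h; rewrite size_mkseq; apply.
  by rewrite inE mem_cat map_f ?orbT// mem_iota.
have eps_le m n : (n <= m)%N -> eps m <= 2%:R^-1 ^+ m * 2%:R^-1 ^+ n.
  move=> nm; have -> : (4%:R^-1 : R) = 2%:R^-1 * 2%:R^-1 by rewrite -invfM -natrM.
  rewrite exprMn ler_wpM2l ?exprn_ge0 ?invr_ge0//.
  by apply: ler_wiXn2l => //; rewrite ?invr_ge0// invf_le1// ler1n.
move=> k i; have [le_ki|lt_ik] := leqP k i.
  apply: ltW; rewrite mulrC; apply: lt_le_trans (eps_le _ _ le_ki).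
  have [_ _ _ h] := uP i; move: h; rewrite size_mkseq; apply.
  move: le_ki; rewrite leq_eqVlt inE mem_cat => /orP[/eqP->|/mem1 ->].
    by rewrite eqxx.
  by rewrite orbT.
apply: ltW; apply: lt_le_trans (eps_le _ _ (ltnW lt_ik)).
have [_ h _ _] := uP k; move: h; rewrite size_mkseq; apply.
by rewrite mem_cat mem2.
Qed.

End CountableDual.
Section PerfectDense.
Variables (R : realType) (X : topologicalZmodType).
Hypotheses (X_hausdorff : hausdorff_space X) (X_compact : compact [set: X]).

Lemma countable_enum (T : choiceType) (A : set T) (x0 : T) : countable A ->
  exists q : nat -> T, A `<=` range q.
Proof.
move=> /countable_injP[f finj].
exists (fun n => xget x0 [set x | A x /\ f x = n]) => x Ax; exists (f x) => //.
case: xgetP => [y _ [Ay E]|/(_ x)]; last by case.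
by apply: finj; rewrite ?inE.
Qed.

Lemma pow_small (b e : R) : 0 <= b <= 2^-1 -> 0 < e ->
  exists N, forall n, (N <= n)%N -> 2 * b ^+ n < e.
Proof.
move=> /andP[b0 b2] e0; exists (Num.truncn (2 / e)).+1 => n nN.
have h : 2 / e < n%:R by rewrite (lt_le_trans (truncnS_gt _))// ler_nat.
have n0 : 0 < n%:R :> R by apply: lt_trans h; rewrite divr_gt0.
have pw m : m%:R * 2^-1 ^+ m <= 1 :> R.
  rewrite exprVn ler_pdivrMr ?exprn_gt0// mul1r -natrX ler_nat.
  exact/ltnW/ltn_expl.
rewrite -(ltr_pM2r n0) -mulrA [_ * n%:R]mulrC.
apply: (@le_lt_trans _ _ 2); last by move: h; rewrite ltr_pdivrMr// mulrC.
rewrite -[leRHS]mulr1 ler_wpM2l//.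
by apply: le_trans (pw n); rewrite ler_wpM2l ?(ltW n0)// lerXn2r ?nnegrE ?invr_ge0.
Qed.

Lemma conv_one_range (e : nat -> {ptws X -> circle R}) x :
  (forall c, 0 < c -> exists N, forall n, (N <= n)%N -> gauge (e n x) < c) ->
  conv_one (range e) x.
Proof.
move=> h U /nbhs_circleP[c c0 cU]; have [N hN] := h c c0.
apply: (@sub_finite_set _ _ (e @` `I_N)); last exact/finite_image/finite_II.
move=> _ [[n _ <-] /= nU]; exists n => //=; rewrite ltnNge; apply/negP => Nn.
by apply: nU; apply: cU; rewrite subr0; exact: hN.
Qed.

(** The perfect set is the closure of [S], the set of finite sums of distinct [a i]
    translated by [K].  The translation by [K] is what makes up for [a m] not
    tending to [0]: by [frequently_near_kernel], [a m - c] is near [0] for suitable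
    [c] in [K] and arbitrarily large [m]. *)
Theorem perfect_dense_convergence (Q : set X) : infinite_set [set: X] -> countable Q ->
  exists B : set {ptws X -> circle R},
    [/\ B `<=` @dual R X, infinite_set B, Q `<=` conv_one B,
        exists P : set X, [/\ P !=set0, perfect_set P & P `<=` conv_one B]
      & dense (conv_one B)].
Proof.
move=> infX cQ.
have := @dual_infinite R X X_hausdorff X_compact infX.
move=> /infiniteP/card_leP[d0].
pose d n := \val (d0 (SigSub (mem_set (I : [set: nat] n)))).
have d_dual n : dual (d n) by exact: set_valP.
have d_inj : injective d.
  by move=> i j /val_inj /(inj (mem_set I) (mem_set I)) /(congr1 val).
pose K := common_kernel d.
have eps0 n : 0 < (4%:R^-1 : R) ^+ n by rewrite exprn_gt0// invr_gt0.
have eps_small : 0 <= (4%:R^-1 : R) <= 2^-1.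
  by rewrite invr_ge0 ler0n /= lef_pV2 ?posrE// ler_nat.
have half_small : 0 <= (2^-1 : R) <= 2^-1 by rewrite lexx invr_ge0 ler0n.
(* Countably many points whose translates by [K] are dense. *)
have /choice[F hF] : forall m, exists s : seq X, forall x, exists2 b, b \in s &
    forall phi, phi \in mkseq d m -> gauge (phi (x - b)) < 4%:R^-1 ^+ m.
  move=> m; apply: (@finite_translates X X_compact [set u |
    forall phi, phi \in mkseq d m -> gauge (phi u) < 4%:R^-1 ^+ m]).
  apply: small_nbhs => //.
  by move=> phi /mapP[i _ ->].
have [q qP] : exists q : nat -> X,
    (Q `<=` range q) /\ forall m b, b \in F m -> range q b.
  have [|q hq] := @countable_enum _
      (\bigcup_(n in [set: nat]) (if n is m.+1 then [set` F m] else Q)) 0.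
    apply: bigcup_countable => // -[|m] _ //.
    by apply: finite_set_countable; exact: finite_seq.
  exists q; split; first by move=> x Qx; apply: hq; exists 0%N.
  by move=> m b bF; apply: hq; exists m.+1.
have [e [a [e_inj e_dual e_q a_K [d_a e_a]]]] :=
  interleaved_choice X_compact d_dual d_inj q.
have conv_q x : range q x -> conv_one (range e) x.
  move=> [i _ <-]; apply: conv_one_range => c c0.
  have [N hN] := pow_small eps_small c0.
  exists (maxn N i.+1) => n; rewrite geq_max => /andP[Nn lt_in].
  apply: lt_trans (e_q _ _ lt_in) _; apply: le_lt_trans (hN n Nn).
  by rewrite ler_peMl ?(ltW (eps0 _))// ler1n.
have d_small (x : nat -> X) :
    (forall m i, (i < m)%N -> gauge (d i (x m)) < 4%:R^-1 ^+ m) ->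
    forall n c, 0 < c -> exists N, forall m, (N <= m)%N -> gauge (d n (x m)) < c.
  move=> hx n c c0; have [N hN] := pow_small eps_small c0.
  exists (maxn N n.+1) => m; rewrite geq_max => /andP[Nm lt_nm].
  apply: lt_trans (hx _ _ lt_nm) _; apply: le_lt_trans (hN m Nm).
  by rewrite ler_peMl ?(ltW (eps0 _))// ler1n.
pose S : set X := [set x | exists M (b : pred nat) c,
  K c /\ x = \sum_(i <- iota 0 M | b i) a i + c].
have e_S k x : S x -> gauge (e k x) <= 2 * 2^-1 ^+ k.
  move=> [M [b [c [Kc ->]]]]; have [dek eK] := e_dual k; have [_ mek] := dek.
  rewrite mek (eK c Kc) addr0.
  suff : gauge (e k (\sum_(i <- iota 0 M | b i) a i)) <=
      2^-1 ^+ k * (2 - 2 * 2^-1 ^+ M).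
    move=> /le_trans; apply; rewrite [leRHS]mulrC ler_wpM2l ?exprn_ge0 ?invr_ge0//.
    by rewrite gerBl mulr_ge0// exprn_ge0// invr_ge0.
  elim: M => [|M ih]; first by rewrite big_nil dual_val0// gauge0 expr0 mulr1 subrr mulr0.
  rewrite -addn1 iotaD big_cat /= mek big_cons big_nil add0n.
  apply: le_trans (gaugeD _ _) _.
  have h : gauge (e k (if b M then a M + 0 else 0)) <= 2^-1 ^+ k * 2^-1 ^+ M.
    case: (b M); first by rewrite addr0.
    by rewrite dual_val0// gauge0 mulr_ge0// exprn_ge0// invr_ge0.
  apply: le_trans (lerD ih h) _; rewrite -mulrDr ler_wpM2l ?exprn_ge0 ?invr_ge0//.
  rewrite addn1 exprS; lra.
have e_P k x : closure S x -> gauge (e k x) <= 2 * 2^-1 ^+ k.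
  move=> Sx; apply/ler_addgt0Pr => c c0; have [dek _] := e_dual k.
  have [|y [Sy /= hy]] := Sx [set y | gauge (e k (y - x)) < c].
    apply/(nbhs_shift x); have := dual_nbhs0 dek c0.
    by apply: filterS => u /=; rewrite addrK.
  have := gaugeD (e k x - e k y) (e k y); rewrite subrK.
  by have := e_S k _ Sy; move: hy; rewrite dual_valB// gaugeB; lra.
exists (range e); split.
- by move=> _ [n _ <-]; have [] := e_dual n.
- exact: range_infinite.
- by move=> x /qP.1/conv_q.
- exists (closure S); split.
  + exists 0; apply: subset_closure; exists 0%N, xpred0, 0; split.
      exact: common_kernel0.
    by rewrite big_nil addr0.
  + split; first exact: closed_closure.
    apply/seteqP; split => [x lx|x Sx U Ux].
      apply: (@closed_closure _ S) => U Ux; have [y [_ Sy Uy]] := lx U Ux.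
      by exists y.
    have [y [Sy Uy]] := Sx _ (open_nbhs_nbhs (conj (@open_interior _ U) Ux)).
    have [/eqP yx|yx] := eqVneq y x; last first.
      by exists y; split => //; [exact: subset_closure|exact: interior_subset].
    move: Sy => [M [b [c [Kc yE]]]].
    (* [x] is itself in [S]: add to it a term [a m] that it does not use, corrected
       by an element of [K]. *)
    have U0 := (nbhs_shift x U).1 Ux.
    have [m [c' [Mm Kc' hm]]] :=
      frequently_near_kernel X_compact d_dual M (d_small _ d_a) U0.
    exists (a m - c' + x); split.
    * apply/eqP => /(canRL (addrK x)); rewrite subrr => /eqP.
      by rewrite subr_eq0 => /eqP E; apply: (a_K m); rewrite E.
    * apply: subset_closure.
      exists m.+1, (fun i => ((i < M)%N && b i) || (i == m)), (c - c'); split.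
        exact: common_kernelB.
      rewrite -addn1 iotaD big_cat /= big_cons big_nil add0n eqxx orbT addr0.
      suff -> : \sum_(i <- iota 0 m | (i < M)%N && b i || (i == m)) a i =
          \sum_(i <- iota 0 M | b i) a i.
        by rewrite -(eqP yx) yE [a m - c' + _]addrC addrACA.
      rewrite -(subnKC Mm) iotaD big_cat /= [X in _ + X]big1_seq ?addr0.
        rewrite big_seq_cond [RHS]big_seq_cond; apply: eq_bigl => i.
        rewrite mem_iota add0n /=; case: ltnP => //= lt_iM.
        by rewrite subnKC// ltn_eqF ?orbF// (leq_trans lt_iM).
      move=> i /andP[/orP[/andP[lt_iM _]|/eqP->]]; rewrite mem_iota add0n subnKC//.
        by rewrite leqNgt lt_iM.
      by rewrite ltnn andbF.
    * exact: hm.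
  + move=> x Px; apply: conv_one_range => c c0.
    have [N hN] := pow_small half_small c0.
    by exists N => n Nn; apply: le_lt_trans (e_P n x Px) (hN n Nn).
- move=> O [y Oy] oO.
  have /choice[f hf] : forall m, exists b, b \in F m /\
      forall phi, phi \in mkseq d m -> gauge (phi (y - b)) < 4%:R^-1 ^+ m.
    by move=> m; have [b bF hb] := hF m y; exists b.
  have O0 : nbhs 0 [set u | O (y - u)].
    have /nbhs_shift : nbhs y O by exact: open_nbhs_nbhs.
    by move=> /nbhs0_opp; apply: filterS => u /=; rewrite addrC.
  have near_f m i : (i < m)%N -> gauge (d i (y - f m)) < 4%:R^-1 ^+ m.
    by move=> lt_im; apply: (hf m).2; apply: map_f; rewrite mem_iota.
  have [m [c [_ Kc hm]]] := frequently_near_kernel (x := fun m => y - f m)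
    X_compact d_dual 0 (d_small _ near_f) O0.
  exists (f m + c); split.
    by move: hm; rewrite /= opprB addrCA subKr addrC.
  move=> U hU; have /qP.2/conv_q/(_ U hU) := (hf m).1.
  apply: sub_finite_set => _ [[n _ <-] nU]; split; first by exists n.
  by have [[_ me] eK] := e_dual n; rewrite /= me (eK c Kc) addr0 in nU.
Qed.

End PerfectDense.
(** * Orthogonality of characters for an invariant probability *)

Section InvariantProbability.
Variables (R : realType) (G : topologicalZmodType) (mu : probability (borel G) R).
Hypothesis mu_inv : forall (a : G) (A : set (borel G)), measurable A ->
  mu [set a + x | x in (A : set G)] = mu A.
Implicit Types (f g : G -> R) (psi : G -> circle R).

Lemma open_borel (A : set G) : open A -> measurable (A : set (borel G)).
Proof. by move=> oA; apply: sub_sigma_algebra. Qed.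

Lemma closed_borel (A : set G) : closed A -> measurable (A : set (borel G)).
Proof.
move=> cA; rewrite -[A]setCK; apply: measurableC.
by apply: open_borel; exact: closed_openC.
Qed.

Lemma continuous_borel f : continuous f -> measurable_fun [set: borel G] (f : borel G -> R).
Proof.
move=> /continuousP cf; apply: (measurability _ (RGenOpens.measurableE R)).
move=> _ [_ [a [b ->] <-]]; rewrite setTI; apply: open_borel.
by apply: cf; exact: interval_open.
Qed.

Definition bounded_continuous f := continuous f /\ exists M, forall x, `|f x| <= M.

Definition integ f : R := Rintegral mu setT (f : borel G -> R).

Lemma bounded_continuous_integrable f : bounded_continuous f ->
  mu.-integrable [set: borel G] (EFin \o (f : borel G -> R)).
Proof.
move=> [cf [M fM]]; apply: measurable_bounded_integrable => //.
- by rewrite ltey_eq fin_num_measure.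
- exact: continuous_borel.
- exists M; split; first exact: num_real.
  by move=> r Mr x _; exact: le_trans (fM x) (ltW Mr).
Qed.

Lemma bounded_continuousD f g : bounded_continuous f -> bounded_continuous g ->
  bounded_continuous (fun x => f x + g x).
Proof.
move=> [cf [M fM]] [cg [N gN]]; split.
  by move=> x; apply: cvgD; [exact: cf|exact: cg].
by exists (M + N) => x; rewrite (le_trans (ler_normD _ _))// lerD.
Qed.

Lemma bounded_continuous_shift f a : bounded_continuous f ->
  bounded_continuous (fun x => f (a + x)).
Proof.
move=> [cf [M fM]]; split; last by exists M => x.
by move=> x; apply: (@cvg_comp _ _ _ (fun y => a + y) f);
  [exact: continuous_addl|exact: cf].
Qed.

Lemma integD f g : bounded_continuous f -> bounded_continuous g ->
  integ (fun x => f x + g x) = integ f + integ g.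
Proof.
by move=> bf bg; rewrite /integ RintegralD//; exact: bounded_continuous_integrable.
Qed.

Lemma integZ c f : bounded_continuous f -> integ (fun x => c * f x) = c * integ f.
Proof.
by move=> bf; rewrite /integ RintegralZl//; exact: bounded_continuous_integrable.
Qed.

Lemma integ_cst c : integ (fun=> c) = c.
Proof.
rewrite /integ Rintegral_cst//.
by rewrite (congr1 fine (probability_setT mu : _ = 1%E)) mulr1.
Qed.

Lemma integ_sum (I : Type) (r : seq I) (F : I -> G -> R) :
  (forall i, bounded_continuous (F i)) ->
  bounded_continuous (fun x => \sum_(i <- r) F i x) /\
  integ (fun x => \sum_(i <- r) F i x) = \sum_(i <- r) integ (F i).
Proof.
move=> bF; elim: r => [|i r [b E]].
  have -> : (fun x => \sum_(i <- [::]) F i x) = (fun=> 0).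
    by apply/funext => x; rewrite big_nil.
  rewrite big_nil integ_cst; split => //; split; first exact: continuous_cst_fun.
  by exists 0 => x; rewrite normr0.
have -> : (fun x => \sum_(j <- i :: r) F j x) =
    (fun x => F i x + \sum_(j <- r) F j x).
  by apply/funext => x; rewrite big_cons.
split; first exact: bounded_continuousD.
by rewrite integD// E big_cons.
Qed.

Lemma integ_shift f a : bounded_continuous f -> integ (fun x => f (a + x)) = integ f.
Proof.
move=> bf; pose t : borel G -> borel G := fun x : G => a + x.
have mt : measurable_fun [set: borel G] t.
  apply: (@measurability _ _ (borel G) (borel G) setT t
    (@open (pointed_group G))) => //.
  move=> _ [A oA <-]; rewrite setTI; apply: open_borel.
  by have /continuousP := @continuous_addl G a; apply.
have preE (A : set (borel G)) : t @^-1` A = [set - a + x | x in (A : set G)].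
  apply/seteqP; split => [x Ax|_ [x Ax <-]].
    by exists (a + x) => //; rewrite addrA addNr add0r.
  by rewrite /t /= addrA subrr add0r.
have bi := bounded_continuous_integrable.
have E : (\int[mu]_x (f x)%:E = \int[pushforward mu t]_x (f x)%:E)%E.
  apply: eq_measure_integral => A mA _ /=.
  by rewrite /pushforward preE mu_inv.
rewrite /integ /Rintegral E (@integral_pushforward _ _ _ _ R t mt mu setT
  (EFin \o (f : borel G -> R))) //.
- by apply/measurable_EFinP; apply: continuous_borel; case: bf.
- exact: (bi _ (bounded_continuous_shift a bf)).
Qed.

Lemma mass_le f (D : set G) c : bounded_continuous f -> (forall x, 0 <= f x) ->
  closed D -> (forall x, D x -> c <= f x) -> 0 < c ->
  (mu (D : set (borel G)) <= (integ f / c)%:E)%E.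
Proof.
move=> bf f0 cD Dc c0; have mD := closed_borel cD.
have muD : mu (D : set (borel G)) \is a fin_num by exact: fin_num_measure.
rewrite -(fineK muD) lee_fin ler_pdivlMr// mulrC.
have -> : fine (mu (D : set (borel G))) = integ (\1_D).
  by rewrite /integ /Rintegral integral_indic// setIT.
have iD : mu.-integrable [set: borel G] (EFin \o (\1_D : borel G -> R)).
  apply: measurable_bounded_integrable => //.
    by rewrite ltey_eq fin_num_measure.
  exists 1; split; first exact: num_real.
  move=> r r1 x _; apply: le_trans (ltW r1).
  by rewrite indicE; case: (_ \in _); rewrite ?normr1 ?normr0.
rewrite /integ -RintegralZl//; apply: le_Rintegral => //.
- exact: (@integrableZl _ _ _ mu setT measurableT c _ iD).
- exact: bounded_continuous_integrable.
move=> x _; rewrite -[leLHS]/(c * (x \in D)%:R).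
have [/set_mem/Dc|_] := boolP (x \in D); first by rewrite mulr1.
by rewrite mulr0.
Qed.

Lemma continuous_re_sub psi b : continuous psi ->
  continuous (fun x => re (psi x - b)).
Proof.
move=> cpsi x.
apply: (@cvg_comp _ _ _ (fun x => psi x - b) (@re R)); last exact: re_continuous.
apply: (@cvg_comp _ _ _ psi (fun u => u - b)); first exact: cpsi.
exact: (@continuous_addr (circle R)).
Qed.

(** Apply the functional equation of [cos] to translates by [a] and by [- a],
    where [psi a <> 0]. *)
Lemma character_integ0 psi b a : continuous psi -> {morph psi : x y / x + y} ->
  psi a <> 0 -> integ (fun x => re (psi x - b)) = 0.
Proof.
move=> cpsi mpsi psia; set f := fun x => _.
have bf : bounded_continuous f.
  split; last by exists 1 => x; rewrite ler_norml re_le1 re_geN1.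
  exact: continuous_re_sub.
have bfs := bounded_continuous_shift.
have E : integ (fun x => f (a + x) + f (- a + x)) = 2 * re (psi a) * integ f.
  rewrite -integZ//; congr integ; apply/funext => x; rewrite /f !mpsi.
  have -> : psi (- a) = - psi a.
    have p0 : psi 0 = 0 by apply: (addIr (psi 0)); rewrite add0r -mpsi addr0.
    by apply/eqP; rewrite -addr_eq0 -mpsi addNr p0.
  by rewrite -!addrA !reD !imD !reN !imN; ring.
rewrite integD// ?integ_shift// in E; try exact: bfs.
have : re (psi a) <> 1 by move/re_eq1.
have : (1 - re (psi a)) * integ f = 0 by lra.
by move=> /eqP; rewrite mulf_eq0 subr_eq0 => /orP[/eqP <-//|/eqP].
Qed.

Definition cluster_set n (psi : 'I_n -> G -> circle R) (y : 'I_n -> circle R) (c : R) :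
    set G :=
  [set x | forall i j, c <= re ((psi i x - y i) - (psi j x - y j))].

(** The squared modulus of the sum of the [n] unit vectors [psi i x - y i] has
    integral [n] by orthogonality, and is at least [c * n ^+ 2] where these vectors
    point in nearly the same direction. *)
Lemma cluster_set_mass n (psi : 'I_n -> G -> circle R) y c : (0 < n)%N -> 0 < c ->
  (forall i, continuous (psi i)) -> (forall i, {morph psi i : x y / x + y}) ->
  (forall i j, i != j -> exists a, psi i a <> psi j a) ->
  closed (cluster_set psi y c) /\
  (mu (cluster_set psi y c : set (borel G)) <= ((n%:R * c)^-1)%:E)%E.
Proof.
move=> n0 c0 cpsi mpsi psi_inj.
pose f i j x := re ((psi i x - y i) - (psi j x - y j)).
have fE i j x : f i j x = re ((psi i x - psi j x) - (y i - y j)).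
  by rewrite /f !opprD !opprK addrACA [_ + y j]addrC.
have cB i j : continuous (fun x => psi i x - psi j x).
  move=> x; apply: (@continuous2_cvg _ (circle R) (circle R) (circle R) (nbhs x) _
    (psi i) (psi j) (fun y z => y - z)).
  - exact: (@sub_continuous (circle R) (psi i x, psi j x)).
  - exact: cpsi.
  - exact: cpsi.
have bf i j : bounded_continuous (f i j).
  split; last by exists 1 => x; rewrite ler_norml re_le1 re_geN1.
  have -> : f i j = fun x => re ((psi i x - psi j x) - (y i - y j)).
    by apply/funext => x; rewrite fE.
  exact: (@continuous_re_sub (fun x => psi i x - psi j x)).
pose F x := \sum_(i < n) \sum_(j < n) f i j x.
have F0 x : 0 <= F x.
  have -> : F x = (\sum_(i < n) re (psi i x - y i)) ^+ 2 +
                  (\sum_(i < n) im (psi i x - y i)) ^+ 2.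
    rewrite !expr2 !mulr_suml -big_split; apply: eq_bigr => i _.
    rewrite !mulr_sumr -big_split; apply: eq_bigr => j _.
    by rewrite /f reB.
  by rewrite addr_ge0 ?sqr_ge0.
have bF i : bounded_continuous (fun x => \sum_(j < n) f i j x).
  by case: (integ_sum (index_enum _) (bf i)).
have IF : integ F = n%:R.
  have [_ ->] := integ_sum (index_enum _) bF.
  transitivity (\sum_(i < n) (1 : R)); last by rewrite sumr_const card_ord.
  apply: eq_bigr => i _; have [_ ->] := integ_sum (index_enum _) (bf i).
  rewrite (bigD1 i)//= big1 ?addr0.
    rewrite -[RHS]integ_cst; congr integ; apply/funext => x.
    by rewrite /f subrr re0.
  move=> j ji; have [|a ha] := psi_inj i j; first by rewrite eq_sym.
  have -> : f i j = fun x => re ((psi i x - psi j x) - (y i - y j)).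
    by apply/funext => x; rewrite fE.
  apply: (@character_integ0 (fun x => psi i x - psi j x) _ a) => //.
    by move=> u v; rewrite !mpsi opprD addrACA.
  by move/eqP; rewrite subr_eq0 => /eqP.
have cD : closed (cluster_set psi y c).
  have -> : cluster_set psi y c = \bigcap_(ij in [set: 'I_n * 'I_n])
      [set x | c <= f ij.1 ij.2 x].
    by apply/seteqP; split => [x h [i j] _|x h i j]; [exact: h|exact: (h (i, j))].
  by apply: closed_bigI => -[i j] _; apply: closed_continuous_ge; case: (bf i j).
split => //.
have bFF : bounded_continuous F by case: (integ_sum (index_enum _) bF).
have nR : 0 < n%:R :> R by rewrite ltr0n.
have := @mass_le F (cluster_set psi y c) (n%:R ^+ 2 * c) bFF F0 cD _ _.
rewrite IF => /(_ _ _)/le_trans; apply.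
- move=> x hx.
  apply: le_trans (ler_sum _ (fun i _ => ler_sum _ (fun j _ => hx i j))).
  by rewrite !sumr_const !card_ord -mulrnA mulnn -natrX mulr_natl.
- by rewrite mulr_gt0// exprn_gt0.
by rewrite lee_fin expr2 -mulrA invfM mulrA divff ?gt_eqF// mul1r.
Qed.

End InvariantProbability.
(** * Null sets of points of convergence, and the closure in the Bohr compactification *)

Lemma re_sub_ge (R : realType) (u v : circle R) (c : R) : 0 < c < 1 ->
  gauge u < (1 - c) / 2 -> gauge v < (1 - c) / 2 -> c <= re (u - v).
Proof.
move=> /andP[c0 c1] hu hv; have := gaugeD u (- v); rewrite gaugeN => h.
have := gauge2 (u - v); have := gauge_ge0 (u - v).
move: (gauge (u - v)) h => g h g0 g2.
have : g ^+ 2 <= (1 - c) ^+ 2.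
  by rewrite ler_pXn2r ?nnegrE//; lra.
by rewrite g2; nra.
Qed.

Lemma inv_half_le (R : realType) (N e : R) : 0 < e -> 4 / e < N ->
  (N * 2^-1)^-1 <= e / 2.
Proof.
move=> e0 h; have N0 : 0 < N by apply: lt_trans h; rewrite divr_gt0.
rewrite -[leRHS]invrK lef_pV2 ?posrE ?mulr_gt0 ?invr_gt0 ?divr_gt0//.
by rewrite invfM invrK; lra.
Qed.

Section Convergence.
Variables (R : realType) (X : topologicalZmodType).
Implicit Types (B : set {ptws X -> circle R}) (x : X).

(** From some index [N] on, the values at a point of [conv_any B] of a sequence of
    distinct characters of [B] are pairwise close; for each [N], the points for
    which this happens form a null set by orthogonality. *)
Theorem conv_any_negligible (mu : probability (borel X) R) B :
  is_haar mu -> B `<=` @dual R X -> infinite_set B -> mu.-negligible (conv_any B).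
Proof.
move=> [mu_inv _ _] Bd /infiniteP/card_leP[f].
pose phi n := \val (f (SigSub (mem_set (I : [set: nat] n)))).
have phiB n : B (phi n) by exact: set_valP.
have phi_inj : injective phi.
  by move=> i j /val_inj /(inj (mem_set I) (mem_set I)) /(congr1 val).
pose E N : set (borel X) := [set x : X | forall i j, (N <= i)%N -> (N <= j)%N ->
  2^-1 <= re (phi i x - phi j x)].
apply: (@negligibleS _ _ _ _ (\bigcup_N E N)).
  move=> x [y _ yx].
  have [m hm] : exists m, forall i, (m <= i)%N -> gauge (phi i x - y) < (1 - 2^-1) / 2.
    have hU : nbhs y [set v | gauge (v - y) < (1 - 2^-1) / 2].
      apply/nbhs_circleP; exists ((1 - 2^-1) / 2) => //.
      by rewrite divr_gt0// subr_gt0 invf_lt1// ltr1n.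
    have := yx _ hU; set C := _ `&` _ => finC.
    have : finite_set (phi @^-1` C).
      by apply: finite_preimage => // i j _ _; exact: phi_inj.
    move=> /finite_seqP[s sE]; exists (\sum_(i <- s) i).+1 => i.
    apply: contraTT; rewrite -leNgt -ltnNge ltnS => h.
    have : i \in s.
      have : [set` s] i by rewrite -sE; split => //=; apply/negP; rewrite -leNgt.
      by [].
    by move=> /(big_rem i) -> /=; rewrite leq_addr.
  exists m => // i j mi mj.
  have -> : phi i x - phi j x = (phi i x - y) - (phi j x - y).
    by rewrite opprB addrA subrK.
  apply: re_sub_ge; [|exact: hm|exact: hm].
  by rewrite invr_gt0 invf_lt1// ltr1n ltr0n.
apply: negligible_bigcup => N.
have half : 0 < 2^-1 :> R by rewrite invr_gt0.
have mass n : (0 < n)%N -> exists D : set (borel X),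
    [/\ measurable D, E N `<=` D & (mu D <= ((n%:R / 2)^-1)%:E)%E].
  move=> n0.
  have [|||clD muD] := @cluster_set_mass R X mu mu_inv n
    (fun i : 'I_n => phi (N + i)) (fun=> 0) 2^-1 n0 half.
  - by move=> i; case: (Bd _ (phiB (N + i)%N)).
  - by move=> i; case: (Bd _ (phiB (N + i)%N)).
  - move=> i j ij; apply: contrapT => no.
    move/eqP: ij; apply; apply/val_inj/(@addnI N)/phi_inj/funext => x.
    by apply: contrapT => h; apply: no; exists x.
  exists (cluster_set (fun i : 'I_n => phi (N + i)) (fun=> 0) 2^-1); split => //.
    exact: closed_borel.
  by move=> x hx i j; rewrite !subr0; apply: hx; rewrite leq_addr.
have /choice[D hD] : forall n, exists D : set (borel X),
    [/\ measurable D, E N `<=` D & (mu D <= ((n.+1%:R / 2)^-1)%:E)%E].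
  by move=> n; exact: mass.
exists (\bigcap_n D n); split.
- by apply: bigcapT_measurable => n; have [] := hD n.
- apply/eqP; rewrite -measure_le0; apply/lee_addgt0Pr => e e0; rewrite add0e.
  pose n := Num.truncn (2 / e).
  have [mD _ hn] := hD n.
  apply: (@le_trans _ _ (mu (D n))).
    apply: le_measure; rewrite ?inE//.
      by apply: bigcapT_measurable => k; have [] := hD k.
    by move=> x; apply.
  apply: le_trans hn _; rewrite lee_fin invf_div ler_pdivrMr// mulrC -ler_pdivrMr//.
  exact/ltW/truncnS_gt.
- by move=> x Ex n _; have [_ + _] := hD n; apply.
Qed.

Hypotheses (X_hausdorff : hausdorff_space X) (X_compact : compact [set: X]).
Hypothesis X_infinite : infinite_set [set: X].

Definition bohr_eval x (g : bohr R X) : circle R := (\val g : {ptws X -> circle R}) x.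

Lemma bohr_eval_continuous x : continuous (bohr_eval x).
Proof.
move=> g.
apply: (@cvg_comp _ _ _ (\val : bohr R X -> {ptws X -> circle R})
  (fun h : {ptws X -> circle R} => h x)).
  exact: (@initial_continuous (bohr R X) {ptws X -> circle R} set_val).
exact: (@proj_continuous {classic X} (fun=> circle R) x).
Qed.

Lemma bohr_eval_neq x y : x <> y -> exists g, bohr_eval x g <> bohr_eval y g.
Proof.
move=> xy; have [|chi dchi chixy] := @characters_separate R X X_hausdorff X_compact (x - y).
  by move/eqP; rewrite subr_eq0 => /eqP.
have clchi : chi \in closure (@dual R X) by rewrite inE; exact: subset_closure.
exists (exist _ chi clchi) => /eqP; rewrite /bohr_eval /= => h.
by apply: chixy; rewrite dual_valB//; apply/eqP; rewrite subr_eq0.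
Qed.

Variable lambda : probability (borel (bohr R X)) R.
Hypothesis lambda_inv : forall (a : bohr R X) (A : set (borel (bohr R X))),
  measurable A -> lambda [set a + x | x in (A : set (bohr R X))] = lambda A.

Lemma bohr_cluster_set_mass (s : seq X) (y : X -> circle R) (c : R) :
  uniq s -> (0 < size s)%N -> 0 < c ->
  let D := cluster_set (fun i : 'I_(size s) => bohr_eval s`_i)
                       (fun i => y s`_i) c in
  closed D /\ (lambda (D : set (borel (bohr R X))) <= (((size s)%:R * c)^-1)%:E)%E.
Proof.
move=> us s0 c0; apply: cluster_set_mass => //.
- by move=> i; exact: bohr_eval_continuous.
- move=> i j ij; apply: bohr_eval_neq => /eqP.
  by rewrite nth_uniq// => /eqP/val_inj/eqP; apply/negP.
Qed.

Lemma uniq_seq_in_infinite (A : set X) n : infinite_set A ->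
  exists s : seq X, [/\ uniq s, (n <= size s)%N & forall x, x \in s -> A x].
Proof.
move=> /(infinite_set_fset n)[S SA nS]; exists (enum_fset S); split => //.
exact: fset_uniq.
Qed.

(** Every [g] belongs to the set of those [h] for which the values [h x - g x] at many
    points [x] are close to each other, and this set has small measure. *)
Lemma finite_closed_cover (l : seq (bohr R X)) (e : R) : 0 < e ->
  exists C : set (bohr R X), [/\ closed C, forall g, g \in l -> C g &
    (lambda (C : set (borel (bohr R X))) <= e%:E)%E].
Proof.
elim: l e => [|g l ih] e e0.
  have h0 : (lambda set0 <= e%:E)%E by rewrite measure0 lee_fin ltW.
  by exists set0; split => //; exact: closed0.
have e2 : 0 < e / 2 by rewrite divr_gt0.
have [C [clC Cl muC]] := ih _ e2.
have [s [us ns _]] := uniq_seq_in_infinite (Num.truncn (4 / e)).+1 X_infinite.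
have s0 : (0 < size s)%N by exact: leq_trans ns.
have half : 0 < 2^-1 :> R by rewrite invr_gt0.
have [clD muD] := bohr_cluster_set_mass (fun x => bohr_eval x g) us s0 half.
set D := cluster_set _ _ _ in clD muD.
exists (C `|` D); split.
- exact: closedU.
- move=> h; rewrite inE => /orP[/eqP->|/Cl]; last by left.
  by right => i j; rewrite !subrr re0 invf_le1// ler1n.
apply: le_trans (measureU2 _ (closed_borel clC) (closed_borel clD)) _.
rewrite [e]splitr EFinD leeD// (le_trans muD)// lee_fin.
have ns' : 4 / e < (size s)%:R by rewrite (lt_le_trans (truncnS_gt _))// ler_nat.
exact: inv_half_le.
Qed.

(** All but finitely many elements of [B] lie in the set of those [g] which take
    nearly the limit value at each point of [s]. *)
Lemma bohr_closure_le B (s : seq X) : B `<=` @dual R X -> uniq s -> (0 < size s)%N ->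
  (forall x, x \in s -> conv_any B x) ->
  (lambda (bohr_closure B : set (borel (bohr R X))) <= ((size s)%:R^-1)%:E)%E.
Proof.
move=> Bd us s0 sB.
have /choice[y hy] : forall x, exists y, x \in s -> conv_to B y x.
  move=> x; have [/sB[y _ yx]|nx] := boolP (x \in s); first by exists y.
  by exists 0.
have ss0 : 0 < (size s)%:R :> R by rewrite ltr0n.
have mcl : measurable (bohr_closure B : set (borel (bohr R X))).
  by apply: closed_borel; exact: closed_closure.
have main c e : 0 < c < 1 -> 0 < e ->
    (lambda (bohr_closure B : set (borel (bohr R X))) <= (((size s)%:R * c)^-1 + e)%:E)%E.
  move=> /andP[c0 c1] e0.
  pose d := (1 - c) / 2.
  have d0 : 0 < d by rewrite divr_gt0// subr_gt0.
  have [clD muD] := bohr_cluster_set_mass y us s0 c0.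
  set D := cluster_set _ _ _ in clD muD.
  pose bad := \bigcup_(x in [set` s]) (B `&` [set phi | ~ gauge (phi x - y x) < d]).
  have /finite_seqP[l lE] : finite_set bad.
    apply: bigcup_finite; first exact: finite_seq.
    move=> x xs; apply: (hy x xs [set v | gauge (v - y x) < d]).
    by apply/nbhs_circleP; exists d.
  have [C [clC Cl muC]] := finite_closed_cover
    (pmap (fun phi => insub phi : option (bohr R X)) l) e0.
  have sub : bohr_closure B `<=` D `|` C.
    apply: subset_trans (closedU clD clC); apply: closure_subset => g /= Bg.
    have [bg|nbg] := pselect (bad (\val g)).
      right; apply: Cl; rewrite mem_pmap; apply/mapP; exists (\val g).
        by have : [set` l] (\val g) by rewrite -lE.
      by rewrite valK.
    left => i j.
    have near (k : 'I_(size s)) : gauge (bohr_eval s`_k g - y s`_k) < d.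
      apply: contrapT => h; apply: nbg; exists s`_k => //=; exact: mem_nth.
    by apply: re_sub_ge; rewrite ?c0 ?c1//; exact: near.
  have mD := closed_borel clD; have mC := closed_borel clC.
  apply: (@le_trans _ _ (lambda (D `|` C : set (borel (bohr R X))))).
    by apply: le_measure; rewrite ?inE//; exact: measurableU.
  by apply: le_trans (measureU2 _ mD mC) _; rewrite EFinD leeD.
apply/lee_addgt0Pr => e e0; rewrite -EFinD.
have e2 : 0 < e / 2 by rewrite divr_gt0.
(* With this value of [c], [1 / c] is [1 + e / 2]. *)
have c01 : 0 < (1 + e / 2)^-1 < 1.
  by rewrite invr_gt0 addr_gt0//= invf_lt1 ?addr_gt0// ltrDl.
apply: le_trans (main _ _ c01 e2) _; rewrite lee_fin invfM invrK mulrDr mulr1.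
rewrite -addrA lerD2l [leRHS]splitr lerD2r ler_piMl ?(ltW e2)//.
by rewrite invf_le1// ler1n.
Qed.

End Convergence.

Theorem theorem1p4 (R : realType) (X : topologicalZmodType)
    (X_hausdorff : hausdorff_space X) (X_compact : compact [set: X])
    (X_infinite : infinite_set [set: X]) :
  [/\ forall mu : probability (borel X) R, is_haar mu ->
        forall B : set {ptws X -> circle R}, B `<=` @dual R X -> infinite_set B ->
          mu.-negligible (conv_any B),
      forall Q : set X, countable Q ->
        exists B : set {ptws X -> circle R},
          [/\ B `<=` @dual R X, infinite_set B, Q `<=` conv_one B,
              exists P : set X, [/\ P !=set0, perfect_set P & P `<=` conv_one B]
            & dense (conv_one B)]
    & forall lambda : probability (borel (bohr R X)) R, is_haar lambda ->
        forall B : set {ptws X -> circle R}, B `<=` @dual R X -> infinite_set B ->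
          (lambda (bohr_closure B) <= (inv_card R (conv_any B))%:E)%E].
Proof.
split.
- move=> mu hmu B; exact: conv_any_negligible.
- move=> Q; exact: perfect_dense_convergence.
move=> lambda [lambda_inv _ _] B Bd infB.
have bound s : uniq s -> (0 < size s)%N -> (forall x, x \in s -> conv_any B x) ->
    (lambda (bohr_closure B) <= ((size s)%:R^-1)%:E)%E.
  by move=> us s0; exact: bohr_closure_le.
rewrite /inv_card; case: asboolP => [fin|inf].
  have [s0|] := posnP #|` fset_set (conv_any B)|.
    exfalso.
    have : (0 : X) \in fset_set (conv_any B).
      rewrite in_fset_set// inE; exists 0 => // U U0.
      apply: (sub_finite_set _ (finite_set0 _)) => phi [/Bd dphi nU].
      by apply: nU; rewrite dual_val0//; exact: nbhs_singleton.
    by rewrite (cardfs0_eq s0).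
  move=> s0; apply: bound => //; first exact: fset_uniq.
  by move=> x; rewrite in_fset_set// inE.
apply/lee_addgt0Pr => e e0; rewrite add0e.
have [s [us ns sB]] := uniq_seq_in_infinite (Num.truncn e^-1).+1 inf.
have s0 : (0 < size s)%N by exact: leq_trans ns.
apply: le_trans (bound s us s0 sB) _; rewrite lee_fin -[leRHS]invrK.
rewrite lef_pV2 ?posrE ?invr_gt0 ?ltr0n//.
by apply: ltW; rewrite (lt_le_trans (truncnS_gt _))// ler_nat.
Qed.
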